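(* Let $(\gamma_n)_{n\ge1}$ be a positive sequence such that $\sum\gamma_n=+\infty$, $\sum\gamma_n^2<\infty$ and $\gamma_{n+1}/\gamma_n\to1$. Assume that the convex function $F:\mathbb R^V\to\mathbb R$ is differentiable and that $\nabla F$ is Lipschitz continuous. Assume that the problem $$\min_{x\in\mathbb R^V}F(x)+R(x,\phi)\qquad(\ast)$$ admits a minimizer. Let $(x_n)$ and $(\bar x_n^i)$ be the sequences generated by the Snake algorithm defined in the context. Then there exists a random variable $X_\star$ such that $X_\star(\omega)$ is a minimizer of $(\ast)$ for $\mathbb P$-almost every $\omega$, and such that $(x_n)$ converges almost surely to $X_\star$ as $n\to\infty$. Moreover, for every $i=0,\dots,L-1$, $\bar x_n^i$ converges almost surely to $X_\star$.
   Context: $G=(V,E)$ is a finite undirected graph with no self-loops, $V$ nonempty, $E\neq\emptyset$. $\phi=(\phi_e)_{e\in E}$ is a family of convex symmetric functions $\phi_e:\mathbb R^2\to\mathbb R$ (symmetric: $\phi_e(a,b)=\phi_e(b,a)$). For $x\in\mathbb R^V$, $R(x,\phi)=\sum_{\{i,j\}\in E}\phi_{\{i,j\}}(x(i),x(j))$. A walk of length $\ell\ge1$ is a sequence $s=(v_0,\dots,v_\ell)$ in $V$ with $\{v_{i-1},v_i\}\in E$ for $i=1,\dots,\ell$; a walk of length $0$ is a single vertex. $\ell(s)$ denotes the length of $s$. Set $R(x,\phi_s)=\sum_{i=1}^{\ell}\phi_{\{v_{i-1},v_i\}}(x(v_{i-1}),x(v_i))$ if $\ell\ge1$, and $R(x,\phi_s)=0$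 if $s$ is a single vertex. For a convex function $g:\mathbb R^V\to\mathbb R$, $\mathrm{prox}_g(y)=\arg\min_x\big(g(x)+\tfrac12\|x-y\|^2\big)$. Random walk. Let $\deg(v)$ be the number of neighbors of $v$, $\pi(v)=\deg(v)/(2|E|)$, and $P(v,w)=\mathbf 1_{\{v,w\}\in E}/\deg(v)$ if $\deg(v)>0$, $P(v,w)=\mathbf 1_{v=w}$ otherwise. Let $(v_k)_{k\in\mathbb N}$ be a Markov chain on $V$ with initial distribution $\pi$ and transition kernel $P$. Fix an integer $L\ge1$. Splitting into simple paths. Define $\tau_0=1$ and, for $i\ge0$, $\tau_{i+1}=\min\{k\ge\tau_i:\ v_k\in\{v_{\tau_i-1},\dots,v_{k-1}\}\}$ if this set is nonempty and $\tau_{i+1}=+\infty$ otherwise (in particular $\tau_{i+1}=+\infty$ if $\tau_i=+\infty$). Let $t_i=\min(\tau_i,L+1)$ for $i\ge0$ and, for $i\ge1$, $\xi^i=(v_{t_{i-1}-1},v_{t_{i-1}},\dots,v_{t_i-1})$, which is almost surely a walk of length at most $L$ (reduced to the single vertex $v_L$ when $t_{i-1}=L+1$). Set $\xi=(\xi^1,\dots,\xi^L)$. Snake algorithm. For $i=1,\dots,L$ and a walk $s$ of length at most $L$, let $f_i(x,s)=\dfrac{\ell(s)}{L|E|}F(x)$ and $g_i(x,s)=\dfrac1L R(x,\phi_s)$. Let $(\xi_n)_{n\ge1}$, $\xi_n=(\xi_n^1,\dots,\xi_n^L)$, be i.i.d. copies of $\xi$ on a probability space $(\Omega,\mathcal F,\mathbb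 P)$, and let $x_0\in\mathbb R^V$ be deterministic. For $n\ge0$ define $\bar x_{n+1}^0=x_n$, $$\bar x_{n+1}^i=\mathrm{prox}_{\gamma_{n+1}g_i(\cdot,\xi_{n+1}^i)}\big(\bar x_{n+1}^{i-1}-\gamma_{n+1}\nabla f_i(\bar x_{n+1}^{i-1},\xi_{n+1}^i)\big),\quad i=1,\dots,L,$$ where $\nabla$ is with respect to the first variable, and $x_{n+1}=\bar x_{n+1}^L$. *)

(* Defs.v *)
From HB Require Import structures.
From mathcomp Require Export all_boot all_order all_algebra.
From mathcomp Require Export all_classical all_reals all_analysis.
Export Order.TTheory GRing.Theory Num.Theory.
Export numFieldNormedType.Exports.

Set Implicit Arguments.
Unset Strict Implicit.
Unset Printing Implicit Defensive.

Local Open Scope classical_set_scope.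
Local Open Scope ring_scope.

(* R^V is encoded as 'rV[R]_#|V|, coordinates being indexed by the enumeration
   of V. *)
Definition at_vertex (V : finType) (R : realType) (x : 'rV[R]_#|V|) (v : V) : R :=
  x ord0 (enum_rank v).

Definition sqnorm (R : realType) n (x : 'rV[R]_n) : R :=
  \sum_(i < n) x ord0 i ^+ 2.

Definition minimizer (T : Type) (R : realType) (f : T -> R) (x : T) : Prop :=
  forall y, f x <= f y.

(* If g is convex the minimizer exists and is unique; otherwise [get] may
   return a default value. *)
Definition prox (R : realType) n (g : 'rV[R]_n -> R) (y : 'rV[R]_n) : 'rV[R]_n :=
  get [set x | minimizer (fun z => g z + 2^-1 * sqnorm (z - y)) x].

Definition gradient (R : realType) n (f : 'rV[R]_n -> R) (x : 'rV[R]_n)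
  : 'rV[R]_n := \row_(i < n) 'd f x (delta_mx ord0 i).

Section Regularization.
Variables (R : realType) (V : finType).
Implicit Types (E : {set {set V}}) (phi : {set V} -> R -> R -> R).

Definition simple_graph E : Prop := forall e, e \in E -> #|e| = 2%N.

(* The order in which [enum e] lists the endpoints is immaterial when phi e is
   symmetric. *)
Definition regularizer E phi (x : 'rV[R]_#|V|) : R :=
  \sum_(e in E)
    if enum e is [:: i; j] then phi e (at_vertex x i) (at_vertex x j) else 0.

(* A walk (v_0, ..., v_l) is the sequence [:: v_0; ...; v_l]. *)
Definition walk_length (s : seq V) : nat := (size s).-1.

Definition walk_regularizer phi (s : seq V) (x : 'rV[R]_#|V|) : R :=
  \sum_(p <- zip s (behead s))
    phi [set p.1; p.2]%SET (at_vertex x p.1) (at_vertex x p.2).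

End Regularization.

Section RandomWalk.
Variables (R : realType) (V : finType) (E : {set {set V}}).

Definition deg (v : V) : nat := #|[set w | [set v; w] \in E]%SET|.

Definition stationary (v : V) : R := (deg v)%:R / (2 * #|E|%:R).

Definition kernel_matrix (v w : V) : R :=
  if (0 < deg v)%N then ([set v; w]%SET \in E)%:R / (deg v)%:R else (v == w)%:R.

(* The last clause is
   P(v_{n+1} = a_{n+1} | v_0 = a_0, ..., v_n = a_n) = kernel(a_n, a_{n+1})
   with the conditioning event multiplied out. *)
Definition markov_chain d (Omega : measurableType d) (P : probability Omega R)
    (v : nat -> Omega -> V) : Prop :=
  [/\ forall k (A : set V), measurable (v k @^-1` A),
      forall a, P (v 0%N @^-1` [set a]) = (stationary a)%:E
    & forall n (a : nat -> V),
        P [set w | forall k, (k <= n.+1)%N -> v k w = a k] =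
        (P [set w | forall k, (k <= n)%N -> v k w = a k]
          * (kernel_matrix (a n) (a n.+1))%:E)%E].

End RandomWalk.

Section Splitting.
Variables (V : finType) (L : nat) (u : nat -> V).

Definition revisits (t k : nat) : bool :=
  (t <= k)%N && (u k \in [seq u j | j <- index_iota t.-1 k]).

(* [None] stands for +oo. *)
Definition next_time (t : nat) : option nat :=
  if pselect (exists k, revisits t k) is left ex then Some (ex_minn ex)
  else None.

Fixpoint tau (i : nat) : option nat :=
  if i is i'.+1 then obind next_time (tau i') else Some 1%N.

Definition cut_time (i : nat) : nat :=
  if tau i is Some k then minn k L.+1 else L.+1.

(* xi^i, for 1 <= i; the upper bound of [index_iota] is excluded. *)
Definition simple_path (i : nat) : seq V :=
  [seq u j | j <- index_iota (cut_time i.-1).-1 (cut_time i)].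

Definition split_paths : L.-tuple (seq V) := [tuple simple_path i.+1 | i < L].

End Splitting.

(* (X_n)_{n >= 1} are independent and distributed as X; T carries the discrete
   sigma-algebra. *)
Definition iid_copies (R : realType) (T : countType)
    d' (Omega' : measurableType d') (P' : probability Omega' R) (X : Omega' -> T)
    d (Omega : measurableType d) (P : probability Omega R)
    (Xs : nat -> Omega -> T) : Prop :=
  [/\ forall n (A : set T), (0 < n)%N -> measurable (Xs n @^-1` A),
      forall n (A : set T), (0 < n)%N ->
        P (Xs n @^-1` A) = P' (X @^-1` A)
    & forall (I : seq nat) (A : nat -> set T),
        uniq I -> (forall n, n \in I -> (0 < n)%N) ->
        P [set w | forall n, n \in I -> A n (Xs n w)] =
        (\prod_(n <- I) P (Xs n @^-1` A n))%E].

(* Measurability for the product sigma-algebra on R^V. *)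
Definition random_vector (R : realType) (V : finType) d
    (Omega : measurableType d) (X : Omega -> 'rV[R]_#|V|) : Prop :=
  forall v, measurable_fun setT (fun w => at_vertex (X w) v).

Section Snake.
Variables (R : realType) (V : finType) (E : {set {set V}}).
Variables (phi : {set V} -> R -> R -> R) (F : 'rV[R]_#|V| -> R) (L : nat).
Variables (gamma : nat -> R) (x0 : 'rV[R]_#|V|).

Definition snake_f (s : seq V) (x : 'rV[R]_#|V|) : R :=
  (walk_length s)%:R / (L%:R * #|E|%:R) * F x.

Definition snake_g (s : seq V) (x : 'rV[R]_#|V|) : R :=
  L%:R^-1 * walk_regularizer phi s x.

Definition snake_update (c : R) (s : seq V) (x : 'rV[R]_#|V|) : 'rV[R]_#|V| :=
  prox (fun z => c * snake_g s z) (x - c *: gradient (snake_f s) x).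

(* [nth [::] s i'] is the path s^{i'+1}. *)
Fixpoint snake_inner (c : R) (s : L.-tuple (seq V)) (x : 'rV[R]_#|V|) (i : nat)
  : 'rV[R]_#|V| :=
  if i is i'.+1 then snake_update c (nth [::] s i') (snake_inner c s x i')
  else x.

Variable xi : nat -> L.-tuple (seq V).

Fixpoint snake (n : nat) : 'rV[R]_#|V| :=
  if n is n'.+1 then snake_inner (gamma n) (xi n) (snake n') L else x0.

(* \bar x_n^i, for 1 <= n. *)
Definition snake_bar (n i : nat) : 'rV[R]_#|V| :=
  snake_inner (gamma n) (xi n) (snake n.-1) i.

End Snake.

(* Main.v *)
Require Import Defs.
From mathcomp Require Import measurable_realfun ring lra zify.

(** Why the theorem is true.

    For a sample s (a tuple of walks) let h_s be the sum over i of
    f_i(., s^i) + g_i(., s^i). The walks s^1, ..., s^L cut one stretch of L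
    steps of the stationary walk, and each step crosses every edge with the
    same probability 1 / |E|; hence the mean of h_s is (F + R(., phi)) / |E|
    ([mean_sample_cost]). The algorithm is therefore an incremental proximal
    gradient method for H = E[h_xi], with i.i.d. samples, and almost sure
    convergence is proved for such methods in general ([iteration_cvg]).

    Fix a minimizer a of H. For small gamma, a prox-gradient step from x to y for a
    cost h satisfies
      |y - a|^2 <= |x - a|^2 - 2 gamma (h(y) - h(a)) - 1/2 |y - x|^2,
    and the difficulty is to bound h(y) - h(a) from below by a function of the
    starting point only. The subgradients of h at x are of no use for this, since
    phi may grow arbitrarily fast. Instead, let z = a + lambda (x - a) be the
    point x pulled back to a fixed ball around a. By convexity, the increment
    h(y) - h(a) is at least the dilated increment at the image of y, namely
    (h(a + lambda (y - a)) - h(a)) / lambda, hence at least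
      q_h(x) - K |y - x|,   where   q_h(x) = (h(z) - h(a)) / lambda,
    with K bounding the slopes of h on that ball only
    ([ray_increment_bounds]). Moreover q_h(x) is linear in h, has growth
    O(|x - a|), and the mean of q_h(x) is q_H(x) >= 0. Summing over a pass, the
    terms K |y - x| are absorbed by the quadratic gains at a cost O(gamma^2)
    ([incremental_pass_le]):
      |x_{n+1} - a|^2 <= |x_n - a|^2 - 2 gamma q_{h_xi}(x_n) + C gamma^2.

    Put D_n = 1 + |x_n - a|^2 and take logarithms:
      ln D_{n+1} <= ln D_n - 2 gamma (q_{h_xi} - q_H)(x_n) / D_n
                    - 2 gamma q_H(x_n) / D_n + C gamma^2.
    The noise term is a martingale increment bounded by a constant times gamma,
    whatever the past, so its series converges almost surely because
    sum gamma^2 is finite; this is Kolmogorov's argument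
    ([maximal_inequality], [martingale_series_cvg]). As ln D_n >= 0, both D_n and
    the series of gamma q_H(x_n) / D_n converge ([cvgn_log_decrease]).

    Almost surely this holds for all a in a countable dense set of minimizers
    and all integer radii of the ball. For a radius exceeding sup |x_n - a| one
    has q_H(x_n) = H(x_n) - H(a), and sum gamma = oo forces
    liminf H(x_n) = min H. A cluster point X along which H(x_n) tends to min H is
    a minimizer, and since |x_n - a| converges for a arbitrarily close to X,
    the whole sequence tends to X ([quasi_fejer_cvg]). The intermediate iterates
    follow because a step from a bounded region moves by O(gamma)
    ([snake_update_dist]). *)

Local Open Scope classical_set_scope.
Local Open Scope ring_scope.
Set Implicit Arguments.
Unset Strict Implicit.

(** * Convex functions with bounded slopes on balls *)

Section ConvexAnalysis.
Variables (R : realType) (n : nat).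
Implicit Types (x y z : 'rV[R]_n) (f g h : 'rV[R]_n -> R).

Lemma convex_functionP (E : lmodType R) (f : E -> R) :
  convex_function setT f <->
  forall (t : R) (x y : E), 0 <= t <= 1 ->
    f (t *: x + (1 - t) *: y) <= t * f x + (1 - t) * f y.
Proof.
split=> [cf t x y /andP[t0 t1]|cf t x y _ _].
  by have := cf (Itv01 t0 t1) x y; rewrite !inE => /(_ I I).
by apply: (cf t%:num); rewrite ge0 le1.
Qed.

Lemma convex_functionD f g : convex_function setT f -> convex_function setT g ->
  convex_function setT (fun x => f x + g x).
Proof.
move=> /convex_functionP cf /convex_functionP cg; apply/convex_functionP=> t x y t01.
have := cf t x y t01; have := cg t x y t01; lra.
Qed.

Lemma convex_functionZ (a : R) f : 0 <= a -> convex_function setT f ->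
  convex_function setT (fun x => a * f x).
Proof.
move=> a0 /convex_functionP cf; apply/convex_functionP=> t x y t01.
have := ler_wpM2l a0 (cf t x y t01); lra.
Qed.

Definition dot x y : R := \sum_(i < n) x ord0 i * y ord0 i.

Lemma dotDl x y z : dot (x + y) z = dot x z + dot y z.
Proof. by rewrite -big_split; apply: eq_bigr => i _; rewrite mxE mulrDl. Qed.

Lemma dotZl (a : R) x y : dot (a *: x) y = a * dot x y.
Proof. by rewrite mulr_sumr; apply: eq_bigr => i _; rewrite mxE mulrA. Qed.

Lemma dotC x y : dot x y = dot y x.
Proof. by apply: eq_bigr => i _; rewrite mulrC. Qed.

Lemma dotNl x y : dot (- x) y = - dot x y.
Proof. by rewrite -scaleN1r dotZl mulN1r. Qed.

Lemma dotBl x y z : dot (x - y) z = dot x z - dot y z.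
Proof. by rewrite dotDl dotNl. Qed.

Lemma dotBr x y z : dot z (x - y) = dot z x - dot z y.
Proof. by rewrite dotC dotBl !(dotC z). Qed.

Lemma sqnormE x : sqnorm x = dot x x.
Proof. by apply: eq_bigr => i _; rewrite expr2. Qed.

Lemma sqnorm_ge0 x : 0 <= sqnorm x.
Proof. by apply: sumr_ge0 => i _; exact: sqr_ge0. Qed.

Lemma sqnormD x y : sqnorm (x + y) = sqnorm x + 2 * dot x y + sqnorm y.
Proof. by rewrite !sqnormE dotDl !(dotC _ (x + y)) !dotDl (dotC y x); ring. Qed.

Lemma sqnormZ (a : R) x : sqnorm (a *: x) = a ^+ 2 * sqnorm x.
Proof. by rewrite !sqnormE dotZl dotC dotZl; ring. Qed.

Lemma sqnorm0 : sqnorm (0 : 'rV[R]_n) = 0.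
Proof. by apply: big1 => i _; rewrite mxE expr0n. Qed.

Lemma sqnorm_triangle z x y :
  sqnorm (x - y) = sqnorm (x - z) + 2 * dot (x - z) (z - y) + sqnorm (z - y).
Proof. by rewrite -sqnormD addrA subrK. Qed.

Lemma ler_dist_add x y : `|y| <= `|x| + `|y - x|.
Proof. by rewrite -{1}[y](subrK x) addrC ler_normD. Qed.

Lemma ler_coord_norm x i : `|x ord0 i| <= `|x|.
Proof.
rewrite [leRHS]mx_normrE.
exact: (le_bigmax _ (fun ij : 'I_1 * 'I_n => `|x ij.1 ij.2|) (ord0, i)).
Qed.

Lemma sqr_norm_le_sqnorm x : `|x| ^+ 2 <= sqnorm x.
Proof.
have [x0|/mx_norm_neq0[[i j] /= xE]] := eqVneq (`|x|) 0.
  by rewrite x0 expr0n sqnorm_ge0.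
rewrite [X in X ^+ 2]xE ord1 real_normK ?num_real// /sqnorm (bigD1 j)//= lerDl.
by apply: sumr_ge0 => k _; exact: sqr_ge0.
Qed.

Lemma sqnorm_le_sqr_norm x : sqnorm x <= n%:R * `|x| ^+ 2.
Proof.
rewrite mulr_natl -[n in _ *+ n]card_ord -sumr_const; apply: ler_sum => i _.
by rewrite -real_normK ?num_real// lerXn2r ?nnegrE// ler_coord_norm.
Qed.

Lemma dot_le_norm x y : dot x y <= n%:R * (`|x| * `|y|).
Proof.
rewrite mulr_natl -[n in _ *+ n]card_ord -sumr_const; apply: ler_sum => i _.
by rewrite (le_trans (ler_norm _))// normrM ler_pM// ler_coord_norm.
Qed.

Lemma norm_le1Dsqnorm x : `|x| <= 1 + sqnorm x.
Proof.
have := sqr_norm_le_sqnorm x; have := sqr_ge0 (2 * `|x| - 1); nra.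
Qed.

Definition bounded_above_on_balls f := forall r : R, exists M : R,
  forall x, `|x| <= r -> f x <= M.

(** For convex functions, [K] bounds the subgradients at the points of the ball;
    stating the resulting affine minoration spares the choice of subgradients. The
    point [y] ranges over the whole space. *)
Definition slope_bounded f := forall r : R, exists2 K : R, 0 <= K &
  forall x y, `|x| <= r -> f x - K * `|y - x| <= f y.

(** Extending the segment from [y] to [x] beyond [x] by a unit length leads to a
    point [w] where [f] is at most [M], and [x] is a barycentre of [w] and [y].
    A lower bound of [f] on the ball comes from the symmetric point [- x]. *)
Lemma convex_slope_bounded f : convex_function setT f ->
  bounded_above_on_balls f -> slope_bounded f.
Proof.
move=> /convex_functionP cf bf r; have [M fM] := bf (`|r| + 1).
have f0M : f 0 <= M by apply: fM; rewrite normr0 addr_ge0.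
exists (2 * M - 2 * f 0) => [|x y xr]; first by lra.
have [->|yx] := eqVneq y x; first by rewrite subrr normr0 mulr0 subr0.
set d := `|y - x|; have d0 : 0 < d by rewrite normr_gt0 subr_eq0.
have xr' : `|x| <= `|r| + 1 by rewrite (le_trans xr)// (le_trans (ler_norm r))// lerDl.
have fxl : 2 * f 0 - M <= f x.
  have h := cf 2^-1 x (- x); have := fM (- x); rewrite normrN => /(_ xr').
  have := h ltac:(lra); rewrite (_ : 2^-1 *: x + (1 - 2^-1) *: - x = 0); first lra.
  by rewrite (_ : 1 - 2^-1 = 2^-1 :> R) ?scalerN ?subrr//; lra.
(* the point at unit distance from x, opposite to y *)
pose w := x - d^-1 *: (y - x).
have wr : f w <= M.
  apply: fM; rewrite (le_trans (ler_normB _ _))// lerD//.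
    by rewrite (le_trans xr)// ler_norm.
  by rewrite normrZ normfV ger0_norm ?(ltW d0)// mulVf// gt_eqF.
have d1 : 0 < 1 + d by lra.
have := cf (d / (1 + d)) w y.
have -> : (d / (1 + d)) *: w + (1 - d / (1 + d)) *: y = x.
  apply/rowP => i; rewrite !mxE; field; lra.
have d01 : 0 <= d / (1 + d) <= 1.
  apply/andP; split; first by rewrite divr_ge0 ?(ltW d0) ?(ltW d1).
  by rewrite ler_pdivrMr// mul1r lerDr.
move=> /(_ d01); rewrite -(ler_pM2l d1).
have -> : (1 + d) * (d / (1 + d) * f w + (1 - d / (1 + d)) * f y) = d * f w + f y.
  by field; lra.
nra.
Qed.

Lemma slope_boundedD f g : slope_bounded f -> slope_bounded g ->
  slope_bounded (fun x => f x + g x).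
Proof.
move=> sf sg r; have [K K0 fK] := sf r; have [K' K'0 gK] := sg r.
exists (K + K'); first exact: addr_ge0.
by move=> x y xr; have := fK x y xr; have := gK x y xr; lra.
Qed.

Lemma slope_boundedZ (a : R) f : 0 <= a -> slope_bounded f ->
  slope_bounded (fun x => a * f x).
Proof.
move=> a0 sf r; have [K K0 fK] := sf r; exists (a * K); first exact: mulr_ge0.
by move=> x y xr; have := ler_wpM2l a0 (fK x y xr); lra.
Qed.

Lemma slope_bounded_continuous f : slope_bounded f -> continuous f.
Proof.
move=> sf x; have [K K0 fK] := sf (`|x| + 1).
apply/(@cvgrPdist_le _ _ _ (nbhs x) (nbhs_filter x)) => e e0.
have d0 : 0 < Num.min 1 (e / (K + 1)) by rewrite lt_min ltr01/= divr_gt0// ltr_wpDl.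
apply: filterS (nbhsx_ballx x _ d0) => y; rewrite mx_norm_ball /ball_/= distrC.
rewrite lt_min => /andP[/ltW xy1 /ltW xyK].
have h1 := fK x y ltac:(rewrite lerDl; lra).
have h2 := fK y x ltac:(have := ler_dist_add x y; lra).
rewrite distrC in h2.
have : K * `|y - x| <= e.
  rewrite ler_pdivlMr ?ltr_wpDl// in xyK; have := normr_ge0 (y - x); nra.
rewrite ler_norml; lra.
Qed.

End ConvexAnalysis.

(** * The proximal operator and prox-gradient steps *)

Section Prox.
Variables (R : realType) (n : nat).
Implicit Types (x y z : 'rV[R]_n) (f g h : 'rV[R]_n -> R).

Lemma slope_bounded_sqnorm : slope_bounded (@sqnorm R n).
Proof.
move=> r; exists (2 * (n%:R * `|r|)).
  by rewrite !mulr_ge0.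
move=> x y xr.
have -> : sqnorm y = sqnorm (x + (y - x)) by rewrite addrC subrK.
rewrite sqnormD.
have := sqnorm_ge0 (y - x).
have := dot_le_norm (- x) (y - x); rewrite dotNl normrN.
have : n%:R * (`|x| * `|y - x|) <= n%:R * (`|r| * `|y - x|).
  by rewrite ler_wpM2l// ler_wpM2r// (le_trans xr)// ler_norm.
lra.
Qed.

Lemma slope_bounded_shift (a : 'rV[R]_n) f : slope_bounded f ->
  slope_bounded (fun x => f (x - a)).
Proof.
move=> sf r; have [K K0 fK] := sf (r + `|a|); exists K => // x y xr.
have -> : y - x = (y - a) - (x - a) by rewrite opprB addrA subrK.
by apply: fK; rewrite (le_trans (ler_normB _ _))// lerD2r.
Qed.

Lemma compact_norm_ball x (r : R) : compact [set z | `|z - x| <= r].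
Proof.
apply: bounded_closed_compact.
  exists (`|x| + r); split; rewrite ?num_real// => M Mr z /= zr.
  by apply: le_trans (ler_dist_add x z) _; lra.
have -> : [set z | `|z - x| <= r] = (fun z => `|z - x|) @^-1` [set t | t <= r] by [].
apply: closed_comp; last exact: closed_le.
move=> z _; apply: continuous_comp; last exact: norm_continuous.
by apply: continuousB => //; exact: cst_continuous.
Qed.

(** Existence of the minimizer: beyond the distance [2 * K] from [y] the quadratic
    term dominates the slope [K] of [g] at [y], so that a minimum over a compact
    ball is a global one. *)
Lemma prox_minimizer g y : convex_function setT g -> slope_bounded g ->
  minimizer (fun z => g z + 2^-1 * sqnorm (z - y)) (prox g y).
Proof.
move=> cg sg; pose G z := g z + 2^-1 * sqnorm (z - y).
suff [x xG] : exists x, minimizer G x.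
  by rewrite /prox; case: xgetP => [z zE //|]; move/(_ x); case.
have [K K0 gK] := sg `|y|.
(* beyond this distance 2^-1 * r ^+ 2 exceeds the possible decrease K * r of g *)
pose r := 2 * K + 1.
have [||| x _ xG] := @EVT_min_rV R n G [set z | `|z - y| <= r].
- by exists y => /=; rewrite subrr normr0 /r; lra.
- exact: compact_norm_ball.
- apply: continuous_subspaceT.
  apply: (@slope_bounded_continuous _ _ G).
  apply: slope_boundedD => //; apply: slope_boundedZ; first lra.
  exact/slope_bounded_shift/slope_bounded_sqnorm.
exists x => z; have [zr|zr] := leP `|z - y| r; first by apply: xG; rewrite inE.
have : G x <= G y by apply: xG; rewrite inE/= subrr normr0 /r; lra.
have := gK y z (lexx _); have := sqr_norm_le_sqnorm (z - y).
rewrite /G subrr sqnorm0.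
rewrite /r in zr; nra.
Qed.

(** Compare [prox g y] with the points of the segment towards [z] and let them tend
    to it: this is the first order condition, that [y - prox g y] is a subgradient
    of [g] at [prox g y]. *)
Lemma prox_le g y z : convex_function setT g -> slope_bounded g ->
  g (prox g y) <= g z + dot (prox g y - y) (z - prox g y).
Proof.
move=> cg sg; set p := prox g y; rewrite -lerBlDl.
apply/ler_addgt0Pr => e e0.
pose s := sqnorm (z - p); have s0 : 0 <= s := sqnorm_ge0 _.
(* the error term t * s must not exceed e *)
pose t := Num.min 1 (e / (s + 1)).
have t0 : 0 < t by rewrite lt_min ltr01 divr_gt0//; lra.
have t1 : t <= 1 by rewrite ge_min lexx.
have ts : t * s <= e.
  have : t <= e / (s + 1) by rewrite ge_min lexx orbT.
  rewrite ler_pdivlMr; nra.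
have := prox_minimizer y cg sg (t *: z + (1 - t) *: p); rewrite -/p => pmin.
have := (convex_functionP g).1 cg t z p ltac:(lra) => gc.
have zE : t *: z + (1 - t) *: p - y = (p - y) + t *: (z - p).
  by apply/rowP => i; rewrite !mxE; ring.
move: pmin; rewrite zE (sqnormD (p - y)) sqnormZ (dotC _ (t *: _)) dotZl.
rewrite (dotC (z - p)) -/s => pmin.
have : t * (g p - g z) <= t * (e + dot (p - y) (z - p)).
  have : t * (t * s) <= t * e by rewrite ler_pM2l.
  nra.
by rewrite ler_pM2l// [e + _]addrC.
Qed.

End Prox.

Section Gradient.
Variables (R : realType) (n : nat).
Implicit Types (x y z : 'rV[R]_n).

Lemma diff_gradient (f : 'rV[R]_n -> R) x z :
  differentiable f x -> 'd f x z = dot (gradient f x) z.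
Proof.
move=> df; rewrite {1}[z]row_sum_delta linear_sum; apply: eq_bigr => i _.
by rewrite linearZ /= mxE mulrC.
Qed.

Lemma gradientZ (a : R) (f : 'rV[R]_n -> R) x : differentiable f x ->
  gradient (fun z => a * f z) x = a *: gradient f x.
Proof.
move=> df; apply/rowP => i; rewrite !mxE.
by have -> : (fun z => a * f z) = a \*: f by []; rewrite diffZ.
Qed.

(** Slopes of chords of a convex function decrease to the directional
    derivative. *)
Lemma convex_gradient_le (f : 'rV[R]_n -> R) x z : convex_function setT f ->
  differentiable f x -> f x + dot (gradient f x) (z - x) <= f z.
Proof.
move=> /convex_functionP cf df; rewrite -diff_gradient// -deriveE// -lerBrDl.
have cq := @diff_derivable _ _ _ _ _ (z - x) df; have /cvg_at_rightE dE := cq.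
rewrite /derive dE; apply: limr_le.
  apply: cvgP; apply: cvg_trans cq.
  by apply: cvg_app; apply: within_subset => /= t t0; rewrite gt_eqF.
near=> t.
have t0 : 0 < t by near: t; exact: nbhs_right_gt.
have t1 : t <= 1 by near: t; exact: nbhs_right_le.
rewrite /= [leLHS]/GRing.scale/= ler_pdivrMl//.
have := cf t z x ltac:(lra).
have -> : t *: z + (1 - t) *: x = t *: (z - x) + x.
  by apply/rowP => i; rewrite !mxE; ring.
lra.
Unshelve. all: end_near. Qed.

End Gradient.

Section Sums.
Variables (R : realType) (n : nat).

Lemma convex_function_sum (I : eqType) (s : seq I) (f : I -> 'rV[R]_n -> R) :
  {in s, forall i, convex_function setT (f i)} ->
  convex_function setT (fun x => \sum_(i <- s) f i x).
Proof.
move=> cf; apply/convex_functionP => t x y t01.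
rewrite !mulr_sumr -big_split /= big_seq [leRHS]big_seq.
by apply: ler_sum => i /cf /convex_functionP; apply.
Qed.

Lemma slope_bounded_sum (I : eqType) (s : seq I) (f : I -> 'rV[R]_n -> R) :
  {in s, forall i, slope_bounded (f i)} ->
  slope_bounded (fun x => \sum_(i <- s) f i x).
Proof.
elim: s => [_ r|i s ih sf].
  by exists 0 => // x y _; rewrite !big_nil mul0r subr0.
rewrite (_ : (fun _ => _) = (fun x => f i x + \sum_(j <- s) f j x)); last first.
  by apply/funext => x; rewrite big_cons.
apply: slope_boundedD; first by apply: sf; rewrite mem_head.
by apply: ih => j js; apply: sf; rewrite inE js orbT.
Qed.

End Sums.

Section Smooth.
Variables (R : realType) (n : nat) (F : 'rV[R]_n -> R).
Hypothesis F_convex : convex_function setT F.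
Hypothesis F_diff : forall x, differentiable F x.
Hypothesis gradF_lip : lipschitz (gradient F).
Implicit Types x y z : 'rV[R]_n.

Lemma lipschitz_gradientP : exists2 M : R, 0 <= M &
  forall x y, `|gradient F x - gradient F y| <= M * `|x - y|.
Proof.
have /pinfty_ex_gt0[M M0 FM] := gradF_lip; exists M; first exact: ltW.
by move=> x y; apply: (FM (x, y)).
Qed.

(** By convexity the remainder is at most
    [dot (gradient F y - gradient F x) (y - x)], which the Lipschitz bound
    controls. *)
Lemma smooth_convex_le : exists2 M : R, 0 <= M & forall x y,
  F y <= F x + dot (gradient F x) (y - x) + M * sqnorm (y - x).
Proof.
have [M M0 FM] := lipschitz_gradientP; exists (n%:R * M); first exact: mulr_ge0.
move=> x y; have := convex_gradient_le x F_convex (F_diff y).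
have := dot_le_norm (gradient F y - gradient F x) (y - x).
have : n%:R * (`|gradient F y - gradient F x| * `|y - x|) <= n%:R * M * sqnorm (y - x).
  rewrite -mulrA ler_wpM2l//.
  apply: (@le_trans _ _ (M * `|y - x| * `|y - x|)); first by rewrite ler_wpM2r.
  by rewrite -mulrA ler_wpM2l// -expr2 sqr_norm_le_sqnorm.
move: (gradient F x) (gradient F y) => gx gy.
have xyN : dot gy (x - y) = - dot gy (y - x).
  by rewrite -[x - y]opprB dotC dotNl dotC.
rewrite (dotBl gy) xyN; lra.
Qed.

Lemma smooth_slope_bounded : slope_bounded F.
Proof.
have [M M0 FM] := lipschitz_gradientP => r.
have [B B0 gB] : exists2 B : R, 0 <= B & forall x, `|x| <= r -> `|gradient F x| <= B.
  exists (`|gradient F 0| + M * `|r|) => [|x xr]; first by rewrite addr_ge0// mulr_ge0.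
  rewrite -[gradient F x](subrK (gradient F 0)) addrC.
  apply: le_trans (ler_normD _ _) _; rewrite lerD2l (le_trans (FM _ _))//.
  by rewrite subr0 ler_wpM2l// (le_trans xr)// ler_norm.
exists (n%:R * B) => [|x y xr]; first exact: mulr_ge0.
have := convex_gradient_le y F_convex (F_diff x).
have := gB x xr; move: (gradient F x) => gx gxB.
have := dot_le_norm (- gx) (y - x); rewrite dotNl normrN.
have : n%:R * (`|gx| * `|y - x|) <= n%:R * B * `|y - x|.
  by rewrite -mulrA ler_wpM2l// ler_wpM2r.
lra.
Qed.

(** The basic descent inequality: the smooth part is bounded below at [z] by its
    tangent at [x] and above at [y] by its quadratic majorant at [x]. *)
Lemma prox_gradient_le (M kappa c : R) (g : 'rV[R]_n -> R) x y z :
  (forall x y, F y <= F x + dot (gradient F x) (y - x) + M * sqnorm (y - x)) ->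
  0 <= kappa -> 0 <= c -> convex_function setT g -> slope_bounded g ->
  y = prox (fun z => c * g z) (x - c *: (kappa *: gradient F x)) ->
  sqnorm (y - z) <= sqnorm (x - z)
    - 2 * c * (kappa * F y + g y - (kappa * F z + g z))
    - (1 - 2 * c * (kappa * M)) * sqnorm (y - x).
Proof.
move=> FM k0 c0 cg sg yE.
have := prox_le (x - c *: (kappa *: gradient F x)) z (convex_functionZ c0 cg)
  (slope_boundedZ c0 sg).
rewrite -yE {yE}.
have := convex_gradient_le z F_convex (F_diff x); have := FM x y.
move: (gradient F x) => gx Fy Fz.
have -> : dot (y - (x - c *: (kappa *: gx))) (z - y) = dot (y - x) (z - x) - sqnorm (y - x)
    + c * kappa * (dot gx (z - x) - dot gx (y - x)).
  have -> : y - (x - c *: (kappa *: gx)) = (y - x) + (c * kappa) *: gx.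
    by apply/rowP => i; rewrite !mxE; ring.
  have -> : z - y = (z - x) - (y - x) by rewrite opprB addrA subrK.
  by rewrite dotDl dotZl !(dotBr (z - x) (y - x)) -sqnormE.
have -> : sqnorm (y - z) = sqnorm (y - x) - 2 * dot (y - x) (z - x) + sqnorm (x - z).
  rewrite (sqnorm_triangle x y z) -[in X in 2 * X](opprB z x).
  by rewrite (dotC (y - x) (- _)) dotNl (dotC (z - x)); ring.
have ck0 : 0 <= c * kappa by rewrite mulr_ge0.
have := ler_wpM2l ck0 Fz; have := ler_wpM2l ck0 Fy; lra.
Qed.

End Smooth.

(** * Passes of incremental steps *)

Section Pass.
Variables (R : realType) (n : nat).
Implicit Types (x y : 'rV[R]_n).

(** The lower bounds on the costs are taken at the start of the pass; the price is
    the drift of the iterates during the pass, which the terms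
    [sqnorm (xs i.+1 - xs i)] pay for up to order [c ^+ 2]. *)
Lemma incremental_pass_le (L : nat) (xs : nat -> 'rV[R]_n) (h : nat -> 'rV[R]_n -> R)
    (a : nat -> R) x0 (c K : R) : 0 <= c -> 0 <= K ->
  (forall i, (i < L)%N -> sqnorm (xs i.+1 - x0) <= sqnorm (xs i - x0)
     - 2 * c * (h i (xs i.+1) - h i x0) - 2^-1 * sqnorm (xs i.+1 - xs i)) ->
  (forall i, (i < L)%N ->
     a i - K * `|xs i.+1 - xs 0%N| <= h i (xs i.+1) - h i x0) ->
  sqnorm (xs L - x0) <= sqnorm (xs 0%N - x0) - 2 * c * (\sum_(i < L) a i)
    + 2 * (L%:R ^+ 3 * K ^+ 2) * c ^+ 2.
Proof.
move=> c0 K0 step low; pose del i := `|xs i.+1 - xs i|.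
have dist i : `|xs i - xs 0%N| <= \sum_(j < i) del j.
  elim: i => [|i ih]; first by rewrite subrr normr0 big_ord0.
  rewrite big_ord_recr/= -[xs i.+1](subrK (xs i)) -addrA addrC.
  exact: le_trans (ler_normD _ _) (lerD ih _).
have distL i : (i < L)%N -> `|xs i.+1 - xs 0%N| <= \sum_(j < L) del j.
  move=> iL; apply: le_trans (dist _) _.
  rewrite (big_ord_widen L del iL) [leRHS](bigID (fun j : 'I_L => (j < i.+1)%N))/=.
  by rewrite lerDl sumr_ge0// => j _; exact: normr_ge0.
set D := \sum_(j < L) del j in distL.
have cK0 : 0 <= 2 * c * K by rewrite !mulr_ge0.
have tele i : (i <= L)%N -> sqnorm (xs i - x0) <= sqnorm (xs 0%N - x0)
    - 2 * c * (\sum_(j < i) a j) + 2 * c * K * D * i%:R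
    - 2^-1 * \sum_(j < i) del j ^+ 2.
  elim: i => [_|i ih iL]; first by rewrite !big_ord0; lra.
  rewrite !big_ord_recr/= -(natr1 i).
  have := ih (ltnW iL); have := step i iL; have := low i iL.
  have := sqr_norm_le_sqnorm (xs i.+1 - xs i); rewrite -/(del i).
  have := ler_wpM2l cK0 (distL i iL).
  move=> h1 h2 h3 h4 h5.
  have h6 : 2 * c * (a i - K * `|xs i.+1 - xs 0%N|) <= 2 * c * (h i (xs i.+1) - h i x0).
    by rewrite ler_wpM2l// mulr_ge0.
  lra.
  have := tele L (leqnn L).
suff : 2 * c * K * D * L%:R - 2^-1 * (\sum_(j < L) del j ^+ 2) <=
  2 * (L%:R ^+ 3 * K ^+ 2) * c ^+ 2 by lra.
rewrite mulrAC !mulr_sumr -sumrB.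
apply: (@le_trans _ _ (\sum_(j < L) 2 * (L%:R * K * c) ^+ 2)).
  (* completing the square, for each step of the pass *)
  apply: ler_sum => j _; have := sqr_ge0 (del j - 2 * (L%:R * K * c)); lra.
by rewrite sumr_const card_ord -mulr_natl le_eqVlt; apply/orP; left; apply/eqP; ring.
Qed.

(** The largest dilation factor in [0, 1] for which the point obtained from [x] by
    dilation of centre [x0] stays at distance at most [r] from [x0]. *)
Definition ray_scale (r : R) x0 x : R := r / Num.max r `|x - x0|.
Definition ray_point (r : R) x0 x : 'rV[R]_n := x0 + ray_scale r x0 x *: (x - x0).
(** A substitute for [h x - h x0] which involves [h] only on the ball of centre [x0]
    and radius [r], and grows at most linearly in [x]. *)
Definition ray_increment (r : R) x0 (h : 'rV[R]_n -> R) x : R :=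
  (h (ray_point r x0 x) - h x0) / ray_scale r x0 x.

Lemma ray_scale_gt0 r x0 x : 0 < r -> 0 < ray_scale r x0 x.
Proof. by move=> r0; rewrite divr_gt0// lt_max r0. Qed.

Lemma ray_scale_le1 r x0 x : 0 < r -> ray_scale r x0 x <= 1.
Proof. by move=> r0; rewrite ler_pdivrMr ?lt_max ?r0// mul1r le_max lexx. Qed.

Lemma norm_ray_point r x0 x : 0 < r ->
  `|ray_point r x0 x - x0| = ray_scale r x0 x * `|x - x0| /\
  `|ray_point r x0 x - x0| <= r.
Proof.
move=> r0; rewrite /ray_point addrAC subrr add0r normrZ gtr0_norm ?ray_scale_gt0//.
split=> //; rewrite mulrAC ler_pdivrMr ?lt_max ?r0//.
by rewrite ler_pM2l// le_max lexx orbT.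
Qed.

Lemma ray_increment_in r x0 h x : 0 < r -> `|x - x0| <= r ->
  ray_increment r x0 h x = h x - h x0.
Proof.
move=> r0 xr; have l1 : ray_scale r x0 x = 1.
  by rewrite /ray_scale max_l// divff// gt_eqF.
by rewrite /ray_increment /ray_point l1 scale1r (addrC x0) subrK divr1.
Qed.

Lemma ray_increment_ge0 r x0 h x : 0 < r -> minimizer h x0 ->
  0 <= ray_increment r x0 h x.
Proof. by move=> r0 hx0; rewrite divr_ge0 ?subr_ge0 ?hx0// ltW// ray_scale_gt0. Qed.

Lemma ray_increment_sum r x0 (I : Type) (s : seq I) (p : I -> R) (h : I -> 'rV[R]_n -> R) x :
  ray_increment r x0 (fun y => \sum_(i <- s) p i * h i y) x =
  \sum_(i <- s) p i * ray_increment r x0 (h i) x.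
Proof.
by rewrite /ray_increment -sumrB mulr_suml; apply: eq_bigr => i _; rewrite -mulrBr mulrA.
Qed.

(** The second bound dilates the pair [x], [y] by the same factor: by convexity
    [h y - h x0] is at least the dilated increment of the image of [y], and the image of
    [x] lies in a ball where the slopes of [h] are bounded. *)
Lemma ray_increment_bounds r x0 h : 0 < r -> convex_function setT h ->
  slope_bounded h -> exists2 K : R, 0 <= K &
    (forall x, `|ray_increment r x0 h x| <= K * `|x - x0|) /\
    (forall x y, ray_increment r x0 h x - K * `|y - x| <= h y - h x0).
Proof.
move=> r0 /convex_functionP ch sh; have [K K0 hK] := sh (`|x0| + r).
exists K => //; split=> [x|x y].
  have [zE zr] := norm_ray_point x0 x r0; have l0 := ray_scale_gt0 x0 x r0.
  set z := ray_point r x0 x in zE zr; set l := ray_scale r x0 x in zE l0.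
  have zb : `|z| <= `|x0| + r.
    by rewrite (le_trans (ler_dist_add x0 z))// lerD2l.
  have := hK z x0 zb; have := hK x0 z ltac:(rewrite lerDl; exact: ltW).
  rewrite (distrC x0) zE => h1 h2.
  rewrite /ray_increment normrM normfV (gtr0_norm l0) ler_pdivrMr//.
  rewrite ler_norml; apply/andP; split; lra.
have [_ zr] := norm_ray_point x0 x r0; have l0 := ray_scale_gt0 x0 x r0.
have l1 := ray_scale_le1 x0 x r0.
set l := ray_scale r x0 x in l0 l1.
have zb : `|ray_point r x0 x| <= `|x0| + r.
  by rewrite (le_trans (ler_dist_add x0 _))// lerD2l.
have := hK _ (l *: y + (1 - l) *: x0) zb.
have -> : l *: y + (1 - l) *: x0 - ray_point r x0 x = l *: (y - x).
  by apply/rowP => i; rewrite !mxE -/l; ring.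
rewrite normrZ (gtr0_norm l0).
have := ch l y x0 ltac:(lra) => h1 h2.
rewrite lerBlDr /ray_increment -/l ler_pdivrMr//; lra.
Qed.

End Pass.

(** * Almost sure convergence of bounded-increment martingales *)

Section Pr.
Context {R : realType} {d : measure_display} {T : measurableType d} (P : probability T R).
Implicit Types A B : set T.

Definition Pr A : R := fine (P A).

Lemma PrE A : measurable A -> P A = (Pr A)%:E.
Proof. by move=> mA; rewrite fineK// fin_num_measure. Qed.

Lemma Pr_ge0 A : 0 <= Pr A.
Proof. by rewrite fine_ge0. Qed.

Lemma Pr_set0 : Pr set0 = 0.
Proof. by rewrite /Pr measure0. Qed.

Lemma Pr_setT : Pr setT = 1.
Proof. by rewrite /Pr probability_setT. Qed.

Lemma le_Pr A B : measurable A -> measurable B -> A `<=` B -> Pr A <= Pr B.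
Proof. by move=> mA mB AB; rewrite -lee_fin -!PrE// le_measure ?inE. Qed.

Lemma PrU_le A B : measurable A -> measurable B -> Pr (A `|` B) <= Pr A + Pr B.
Proof.
move=> mA mB; rewrite -lee_fin EFinD -!PrE//; last exact: measurableU.
exact: measureU2.
Qed.

Lemma PrU A B : measurable A -> measurable B -> A `&` B = set0 ->
  Pr (A `|` B) = Pr A + Pr B.
Proof.
move=> mA mB AB; apply: EFin_inj; rewrite EFinD -!PrE ?measureU//.
exact: measurableU.
Qed.

Lemma Pr_cover_le (I : eqType) (s : seq I) A B (F : I -> set T) :
  measurable A -> measurable B -> (forall i, measurable (F i)) ->
  P B = 0%E -> A `<=` B `|` \bigcup_(i in [set` s]) F i ->
  Pr A <= \sum_(i <- s) Pr (F i).
Proof.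
move=> mA mB mF B0; elim: s A mA => [|i s ih] A mA AF.
  rewrite big_nil -[leRHS](_ : Pr B = 0); last by rewrite /Pr B0.
  by apply: le_Pr => // x /AF[//|[]].
rewrite big_cons; apply: (@le_trans _ _ (Pr (F i `|` (A `\` F i)))).
  apply: le_Pr => //; first by apply: measurableU => //; exact: measurableD.
  by move=> x Ax; have [Fx|Fx] := pselect (F i x); [left|right].
apply: le_trans (PrU_le _ _) _ => //; first exact: measurableD.
rewrite lerD2l; apply: ih; first exact: measurableD.
move=> x [/AF Ax nF]; case: Ax => [Bx|[j js Fj]]; first by left.
by case/predU1P: js => [ji|js]; [move: Fj; rewrite ji => /nF|right; exists j].
Qed.

End Pr.

Section Martingale.
Context {R : realType} {d : measure_display} {T : measurableType d} (P : probability T R).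
Variables (S : countType) (s0 : S) (eta : nat -> T -> S) (p : S -> R) (supp : seq S).

Definition trajectory (w : T) : nat -> S := fun k => eta k w.
Definition cylinder (N : nat) (u : nat -> S) : set T :=
  [set w | forall k, (k < N)%N -> eta k w = u k].
Definition update_at (u : nat -> S) (N : nat) (s : S) : nat -> S :=
  fun k => if k == N then s else u k.
(** Adaptedness: [f u] is a function of [u 0], ..., [u N.-1]. *)
Definition determined (N : nat) X (f : (nat -> S) -> X) : Prop :=
  forall u u', (forall k, (k < N)%N -> u k = u' k) -> f u = f u'.

Hypothesis eta_meas : forall k (A : set S), measurable (eta k @^-1` A).

Lemma measurable_cylinder N u : measurable (cylinder N u).
Proof.
have -> : cylinder N u = \big[setI/setT]_(k < N) (eta k @^-1` [set u k]).
  by rewrite -(bigcap_mkord N (fun k => eta k @^-1` [set u k])).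
by apply: bigsetI_measurable => k _; exact: eta_meas.
Qed.

(** The sample space is countable, hence such an event is a countable union of
    cylinders. *)
Lemma measurable_determined N (Q : (nat -> S) -> Prop) : determined N Q ->
  measurable [set w | Q (trajectory w)].
Proof.
move=> dQ.
pose A n : set T := if unpickle n is Some h then
  if `[< Q (nth s0 h) >] then cylinder N (nth s0 h) else set0 else set0.
have -> : [set w | Q (trajectory w)] = \bigcup_n A n.
  apply/seteqP; split => [w /= Qw|w [n _]].
    exists (pickle (mkseq (trajectory w) N)) => //; rewrite /A pickleK.
    have ext k : (k < N)%N -> trajectory w k = nth s0 (mkseq (trajectory w) N) k.
      by move=> kN; rewrite nth_mkseq.
    by rewrite (dQ _ _ ext) in Qw; rewrite asboolT.
  rewrite /A; case: unpickle => [h|//]; case: asboolP => [Qh wh|//] /=.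
  by rewrite (dQ (trajectory w) (nth s0 h)).
apply: bigcupT_measurable => n; rewrite /A; case: unpickle => [h|//].
by case: asboolP => _ //; exact: measurable_cylinder.
Qed.

Hypothesis p_ge0 : forall s, 0 <= p s.
Hypothesis p_sum : \sum_(s <- supp) p s = 1.
Hypothesis eta_supp : forall k, P (eta k @^-1` [set s | s \notin supp]) = 0%E.
Hypothesis cylinderS : forall N u,
  Pr P (cylinder N.+1 u) = Pr P (cylinder N u) * p (u N).

Lemma cylinder_update_at N u s : cylinder N (update_at u N s) = cylinder N u.
Proof.
by apply/seteqP; split => w h k kN; rewrite h// /update_at ltn_eqF.
Qed.

Section MaximalInequality.
Variables (c : nat -> (nat -> S) -> R) (b : nat -> R).
Hypothesis c_det : forall k, determined k.+1 (c k).
Hypothesis c_mean0 : forall k u, \sum_(s <- supp) p s * c k (update_at u k s) = 0.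
Hypothesis c_bound : forall k u, u k \in supp -> `|c k u| <= b k.

Let M n u := \sum_(0 <= k < n) c k u.

Lemma partial_sum_det n : determined n (M n).
Proof.
move=> u u' uu'; apply: eq_big_nat => k /andP[_ kn]; apply: c_det => j jk.
by apply: uu'; exact: leq_trans jk kn.
Qed.

Lemma exceed_det N n e :
  determined (N + n) (fun u => exists2 k, (k <= n)%N & e <= `|M (N + k) u|).
Proof.
move=> u u' uu'; apply/propext; split => -[k kn h]; exists k => //.
  by rewrite -(partial_sum_det (u := u))// => j jk; apply: uu'; rewrite (leq_trans jk)// leq_add2l.
by rewrite (partial_sum_det (u' := u'))// => j jk; apply: uu'; rewrite (leq_trans jk)// leq_add2l.
Qed.

(** Kolmogorov's inequality, conditionally on the first [N] samples and with [n]
    samples left. By induction on [n], one conditions on the next sample: as long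
    as the threshold is not reached, the square of the partial sum has mean at
    most [M N u ^+ 2 + b N ^+ 2] after one more step. *)
Lemma maximal_cylinder (e : R) : 0 < e -> forall n N u,
  e ^+ 2 * Pr P (cylinder N u `&`
     [set w | exists2 k, (k <= n)%N & e <= `|M (N + k) (trajectory w)|]) <=
  Pr P (cylinder N u) * (M N u ^+ 2 + \sum_(N <= k < N + n) b k ^+ 2).
Proof.
move=> e0; have mE N n := measurable_determined (@exceed_det N n e).
have mC := measurable_cylinder.
elim=> [|n ih] N u; have [eM|Me] := leP e `|M N u|.
- rewrite mulrC ler_pM ?Pr_ge0 ?sqr_ge0//.
    by apply: le_Pr => //; exact: measurableI.
  rewrite addn0 big_geq// addr0 -[leRHS]real_normK ?num_real//.
  by rewrite lerXn2r ?nnegrE// ltW.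
- rewrite [X in Pr P X](_ : _ = set0); last first.
    apply/seteqP; split => // w [wu [k]] /=; rewrite leqn0 => /eqP ->.
    by rewrite addn0 (partial_sum_det (u' := u))// leNgt Me.
  rewrite Pr_set0 mulr0 mulr_ge0 ?Pr_ge0// addr_ge0 ?sqr_ge0// sumr_ge0// => k _.
  exact: sqr_ge0.
- rewrite mulrC ler_pM ?Pr_ge0 ?sqr_ge0//.
    by apply: le_Pr => //; exact: measurableI.
  rewrite ler_wpDr//; first by rewrite sumr_ge0// => k _; rewrite sqr_ge0.
  rewrite -[leRHS]real_normK ?num_real//.
  by rewrite lerXn2r ?nnegrE// ltW.
pose C := Pr P (cylinder N u).
(* the variance bound left after one more sample *)
pose r := \sum_(N.+1 <= k < N.+1 + n) b k ^+ 2.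
have step : Pr P (cylinder N u `&`
     [set w | exists2 k, (k <= n.+1)%N & e <= `|M (N + k) (trajectory w)|]) <=
   \sum_(s <- supp) Pr P (cylinder N.+1 (update_at u N s) `&`
     [set w | exists2 k, (k <= n)%N & e <= `|M (N.+1 + k) (trajectory w)|]).
  apply: (Pr_cover_le (B := eta N @^-1` [set s | s \notin supp])) => //.
  - exact: measurableI.
  - by move=> s; apply: measurableI => //; exact: mE.
  move=> w [wu [k kn ek]]; have [ws|ws] := boolP (eta N w \in supp); last by left.
  right; exists (eta N w) => //; split.
    move=> j; rewrite ltnS leq_eqVlt /update_at => /orP[/eqP ->|jN]; first by rewrite eqxx.
    by rewrite ltn_eqF// wu.
  case: k => [|k] in kn ek *.
    by move: ek; rewrite addn0 (partial_sum_det (u' := u))// leNgt Me.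
  by exists k => //; rewrite addSnnS.
apply: le_trans (ler_wpM2l (sqr_ge0 _) step) _; rewrite mulr_sumr.
apply: (@le_trans _ _ (\sum_(s <- supp)
    C * p s * ((M N u + c N (update_at u N s)) ^+ 2 + r))).
  apply: ler_sum => s _; apply: le_trans (ih _ _) _.
  rewrite cylinderS cylinder_update_at /update_at eqxx -/C /M big_nat_recr//=.
  rewrite -!/(M _ _) (partial_sum_det (u' := u))// => j jN; by rewrite ltn_eqF.
have -> : \sum_(N <= k < N + n.+1) b k ^+ 2 = b N ^+ 2 + r.
  by rewrite big_ltn ?addnS ?ltnS ?leq_addr// addSn.
(* the cross term vanishes because the increments have mean zero *)
have -> : \sum_(s <- supp) C * p s * ((M N u + c N (update_at u N s)) ^+ 2 + r) =
    C * (M N u ^+ 2 + r) * (\sum_(s <- supp) p s)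
    + 2 * C * M N u * (\sum_(s <- supp) p s * c N (update_at u N s))
    + C * (\sum_(s <- supp) p s * c N (update_at u N s) ^+ 2).
  by move: (M N u) => m; rewrite !mulr_sumr -!big_split/=; apply: eq_bigr => s _; ring.
rewrite p_sum c_mean0.
have C0 : 0 <= C := Pr_ge0 _ _.
suff : \sum_(s <- supp) p s * c N (update_at u N s) ^+ 2 <= b N ^+ 2.
  by move=> /(ler_wpM2l C0); move: (M N u) => m; rewrite -/C; lra.
rewrite -[leRHS]mul1r -p_sum mulr_suml big_seq [leRHS]big_seq.
apply: ler_sum => s ssupp; rewrite ler_wpM2l// -real_normK ?num_real//.
have bc : `|c N (update_at u N s)| <= b N by apply: c_bound; rewrite /update_at eqxx.
by rewrite lerXn2r ?nnegrE// (le_trans _ bc).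
Qed.

Lemma maximal_inequality (e : R) n : 0 < e ->
  e ^+ 2 * Pr P [set w | exists2 k, (k <= n)%N & e <= `|M k (trajectory w)|] <=
  \sum_(0 <= k < n) b k ^+ 2.
Proof.
move=> e0; have := maximal_cylinder e0 n 0 (fun=> s0).
have -> : cylinder 0 (fun=> s0) = setT by apply/seteqP; split.
by rewrite setTI Pr_setT mul1r /M big_nil expr0n add0r.
Qed.

End MaximalInequality.

Variables (c : nat -> (nat -> S) -> R) (b : nat -> R).
Hypothesis c_det : forall k, determined k.+1 (c k).
Hypothesis c_mean0 : forall k u, \sum_(s <- supp) p s * c k (update_at u k s) = 0.
Hypothesis c_bound : forall k u, u k \in supp -> `|c k u| <= b k.
Hypothesis b_sum2 : cvgn (series (fun k => b k ^+ 2)).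

Let tail_exceed (e : R) N n : set T :=
  [set w | exists2 k, (k <= n)%N & e <= `|\sum_(N <= j < k) c j (trajectory w)|].

Lemma measurable_tail_exceed e N n : measurable (tail_exceed e N n).
Proof.
apply: (@measurable_determined n
  (fun u => exists2 k, (k <= n)%N & e <= `|\sum_(N <= j < k) c j u|)).
move=> u u' uu'; apply/propext.
have E k : (k <= n)%N -> \sum_(N <= j < k) c j u = \sum_(N <= j < k) c j u'.
  move=> kn; apply: eq_big_nat => j /andP[_ jk]; apply: c_det => i ij.
  by apply: uu'; apply: leq_trans kn; exact: leq_trans ij jk.
by split => -[k kn h]; exists k => //; rewrite ?E// -E.
Qed.

Lemma tail_maximal e N n : 0 < e ->
  e ^+ 2 * Pr P (tail_exceed e N n) <=
  limn (series (fun k => b k ^+ 2)) - series (fun k => b k ^+ 2) N.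
Proof.
move=> e0; pose on k (x : R) := if (N <= k)%N then x else 0.
have sumE (f : nat -> R) k : \sum_(0 <= j < k) on j (f j) = \sum_(N <= j < k) f j.
  by rewrite -big_mkcond/= [RHS](big_nat_widenl _ 0).
have on_det k : determined k.+1 (fun u => on k (c k u)).
  by move=> u u' uu'; rewrite /on; case: ifP => // _; exact: c_det.
have on_mean0 k u : \sum_(s <- supp) p s * on k (c k (update_at u k s)) = 0.
  by rewrite /on; case: (N <= k)%N => //; rewrite big1// => s _; rewrite mulr0.
have on_bound k u : u k \in supp -> `|on k (c k u)| <= on k (b k).
  by move=> us; rewrite /on; case: ifP => [_|_]; [exact: c_bound|rewrite normr0].
have := maximal_inequality on_det on_mean0 on_bound n e0.
have -> : [set w | exists2 k, (k <= n)%N &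
    e <= `|\sum_(0 <= j < k) on j (c j (trajectory w))|] = tail_exceed e N n.
  by apply/seteqP; split => w [k kn]; rewrite ?(sumE (fun j => c j (trajectory w))) => h;
    exists k => //; rewrite ?(sumE (fun j => c j (trajectory w))).
have -> : \sum_(0 <= k < n) on k (b k) ^+ 2 = \sum_(N <= k < n) b k ^+ 2.
  rewrite -(sumE (fun k => b k ^+ 2)); apply: eq_bigr => k _; rewrite /on; case: ifP => // _.
  by rewrite expr0n.
have nd : {homo series (fun k => b k ^+ 2) : m m' / (m <= m')%N >-> m <= m'}.
  apply/nondecreasing_seqP => k; rewrite seriesSr lerDl; exact: sqr_ge0.
have lim_ge k := nondecreasing_cvgn_le nd b_sum2 k.
move=> /le_trans; apply.
have [Nn|nN] := leqP N n; last by rewrite big_geq ?(ltnW nN)// subr_ge0.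
rewrite lerBrDr; apply: le_trans (lim_ge n).
by rewrite /series/= addrC -big_cat_nat.
Qed.

(** By the maximal inequality applied to the tails of the series, the event of an
    oscillation larger than [e] in every tail has probability zero. *)
Theorem martingale_series_cvg :
  {ae P, forall w, cvgn (series (fun k => c k (trajectory w)))}.
Proof.
pose bad (e : R) : set T := \bigcap_N \bigcup_n tail_exceed e N n.
have mbad e : measurable (bad e).
  apply: bigcapT_measurable => N; apply: bigcupT_measurable => n.
  exact: measurable_tail_exceed.
have bad0 e : 0 < e -> P (bad e) = 0%E.
  move=> e0; apply/eqP; rewrite eq_le measure_ge0 andbT.
  pose rest N := limn (series (fun k => b k ^+ 2)) - series (fun k => b k ^+ 2) N.
  have Pr_bad N : Pr P (bad e) <= rest N / e ^+ 2.
    have mU : measurable (\bigcup_n tail_exceed e N n).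
      by apply: bigcupT_measurable => n; exact: measurable_tail_exceed.
    have PU : (P (\bigcup_n tail_exceed e N n) <= (rest N / e ^+ 2)%:E)%E.
      have nd : {homo tail_exceed e N : m m' / (m <= m')%N >-> (m <= m')%O}.
        move=> m m' mm'; apply/subsetPset => w [k km ek].
        by exists k => //; exact: leq_trans mm'.
      have cP := @nondecreasing_cvg_mu _ _ _ P _ (measurable_tail_exceed e N) mU nd.
      rewrite -(cvg_lim _ cP)//; apply: lime_le; first exact: cvgP cP.
      apply: nearW => n /=; rewrite PrE; last exact: measurable_tail_exceed.
      by rewrite lee_fin ler_pdivlMr ?exprn_gt0// mulrC tail_maximal.
    rewrite -lee_fin -PrE//; apply: le_trans PU; apply: le_measure; rewrite ?inE//.
    by move=> w; apply.
  rewrite PrE// lee_fin.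
  have rest0 : rest N / e ^+ 2 @[N --> \oo] --> 0.
    rewrite -[X in _ --> X](mul0r (e ^+ 2)^-1); apply: cvgMl.
    rewrite -(subrr (limn (series (fun k => b k ^+ 2)))).
    by apply: cvgB => //; exact: cvg_cst.
  by rewrite -(cvg_lim _ rest0)//; apply: limr_ge; [exact: cvgP rest0|exact: nearW].
have : {ae P, forall w, forall j : nat, ~ bad (j.+1%:R^-1) w}.
  apply: ae_foralln => j; exists (bad j.+1%:R^-1); split=> //.
    by apply: bad0; rewrite invr_gt0.
  by move=> w /contrapT.
apply: filterS => w wgood.
apply/cauchy_cvgP/cauchy_seriesP => e e0.
have [j je] : exists j : nat, j.+1%:R^-1 < e / 2.
  have e20 : 0 < e / 2 by lra.
  have [j] := near_infty_natSinv_lt (PosNum e20).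
  by move=> _ /(_ _ (leqnn _)) h; exists j.
have [N hN] : exists N, forall k, `|\sum_(N <= i < k) c i (trajectory w)| < j.+1%:R^-1.
  apply: contrapT => h; apply: (wgood j) => N _; apply: contrapT => h'.
  apply: h; exists N => k; rewrite ltNge; apply/negP => ek.
  by apply: h'; exists k => //; exists k.
exists ([set k | (N <= k)%N], [set k | (N <= k)%N]); first by split; exists N.
move=> [m m'] [/= Nm Nm']; have [mm'|m'm] := leqP m m'; last first.
  by rewrite big_geq ?(ltnW m'm)// normr0.
have -> : \sum_(m <= k < m') c k (trajectory w) =
   \sum_(N <= k < m') c k (trajectory w) - \sum_(N <= k < m) c k (trajectory w).
  by rewrite (big_cat_nat Nm mm')/= addrAC subrr add0r.
apply: le_lt_trans (ler_normB _ _) _; have := ltrD (hN m') (hN m).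
by move=> /lt_trans; apply; rewrite [ltRHS](splitr e) ltrD.
Qed.

End Martingale.

(** * Deterministic convergence criteria *)

Section Deterministic.
Variable (R : realType).

Lemma cvgn_bounded (u : nat -> R) : cvgn u -> exists B : R, forall k, `|u k| <= B.
Proof.
move=> /cvg_seq_bounded [M [_ hM]]; exists (M + 1) => k.
by apply: (hM (M + 1)) => //; rewrite ltrDl.
Qed.

(** In terms of [ln (D k)] the multiplicative recursion becomes additive, with
    [ln (1 + t) <= t]: up to the convergent series of [c], the sequence [ln \o D] is
    eventually nonincreasing, and it is nonnegative. *)
Lemma cvgn_log_decrease (D c e : nat -> R) :
  (forall k, 1 <= D k) -> (forall k, 0 <= e k) ->
  (\forall k \near \oo, D k.+1 <= D k * (1 + c k - e k)) ->
  cvgn (series c) ->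
  cvgn D /\ exists B : R, forall k, series e k <= B.
Proof.
move=> D1 e0 [N _ DN] cc.
have D0 k : 0 < D k by exact: lt_le_trans ltr01 (D1 k).
have [B cB] := cvgn_bounded cc.
have lnD k : (N <= k)%N -> ln (D k.+1) <= ln (D k) + c k - e k.
  move=> Nk; have Dk := DN _ Nk.
  have t0 : 0 < 1 + (c k - e k).
    by rewrite addrA -(pmulr_rgt0 _ (D0 k)); exact: lt_le_trans (D0 _) Dk.
  rewrite -addrA -lerBlDl.
  apply: le_trans (le_ln1Dx _); last by lra.
  rewrite lerBlDl -lnM ?posrE// ler_ln ?posrE ?mulr_gt0//.
  by rewrite addrA.
pose U k := ln (D k) - series c k.
have Udecr k : (N <= k)%N -> U k.+1 + series e k.+1 <= U k + series e k.
  by move=> Nk; rewrite /U !seriesSr; have := lnD k Nk; lra.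
have lowU k : - B <= U k.
  have := cB k; rewrite ler_norml => /andP[_]; have := ln_ge0 (D1 k).
  rewrite /U; lra.
have e_nd : {homo series e : k k' / (k <= k')%N >-> k <= k'}.
  by apply/nondecreasing_seqP => k; rewrite seriesSr lerDl.
have cU : cvgn U.
  suff [l Ul] : exists l : R, (fun k => U (k + N)%N) @ \oo --> l.
    by apply/cvg_ex; exists l; rewrite -(cvg_shiftn N).
  have : cvgn (fun k => U (k + N)%N).
    apply: nonincreasing_is_cvgn; last by exists (- B) => _ [k _ <-].
    apply/nonincreasing_seqP => k; have := Udecr (k + N)%N (leq_addl _ _).
    by rewrite seriesSr addSn; have := e0 (k + N)%N; lra.
  by move/cvg_ex.
split.
  have -> : D = (fun k => expR (U k + series c k)).
    by apply/funext => k; rewrite /U subrK lnK ?posrE.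
  apply: cvgP; apply: (continuous_cvg _ (@continuous_expR R _)).
  by apply: cvgD; [exact: cU|exact: cc].
exists (U N + series e N + B) => k.
have h m : U (m + N)%N + series e (m + N)%N <= U N + series e N.
  elim: m => [//|m]; apply: le_trans; rewrite addSn; apply: Udecr; exact: leq_addl.
apply: (@le_trans _ _ (series e (k + N)%N)); first exact: e_nd (leq_addr _ _).
by have := h k; have := lowU (k + N)%N; lra.
Qed.

Variable n : nat.
Implicit Types x y : 'rV[R]_n.

Lemma rat_row_dense x (e : R) : 0 < e ->
  exists q : 'rV[rat]_n, `|x - map_mx ratr q| < e.
Proof.
move=> e0; have /choice[q qx] : forall i, exists q : rat, `|x ord0 i - ratr q| < e.
  move=> i; have : x ord0 i - e < x ord0 i + e by lra.
  move=> /rat_in_itvoo[q]; rewrite in_itv/= => /andP[q1 q2]; exists q.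
  rewrite ltr_norml; lra.
exists (\row_i q i); rewrite [ltLHS]mx_normrE; apply: bigmax_lt => // -[i j] _ /=.
by rewrite ord1 !mxE.
Qed.

(** A separable space is hereditarily so: choose a point of [A] in each ball with
    rational centre and radius [1 / k.+1] which meets [A]. *)
Lemma countable_dense_subset (A : set 'rV[R]_n) : A !=set0 ->
  exists2 C : nat -> 'rV[R]_n, (forall m, A (C m)) &
    forall y (e : R), A y -> 0 < e -> exists m, `|C m - y| < e.
Proof.
move=> [a0 Aa0].
pose near_pt (qk : 'rV[rat]_n * nat) y := A y /\ `|y - map_mx ratr qk.1| < qk.2.+1%:R^-1.
have /choice[C hC] : forall m : nat, exists y : 'rV[R]_n, A y /\
    (forall qk, unpickle m = Some qk -> (exists z, near_pt qk z) -> near_pt qk y).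
  move=> m; case E : (unpickle m) => [qk|]; last by exists a0.
  have [[z zq]|nz] := pselect (exists z, near_pt qk z).
    by exists z; split => [|_ [<-]//]; exact: zq.1.
  by exists a0; split => // _ [<-].
exists C => [m|y e Ay e0]; first exact: (hC m).1.
have e20 : 0 < e / 2 by lra.
have [k _ /(_ _ (leqnn _))/= ke] := near_infty_natSinv_lt (PosNum e20).
have k0 : 0 < k.+1%:R^-1 :> R by rewrite invr_gt0.
have [q yq] := rat_row_dense y k0.
exists (pickle (q, k)).
have [_ /(_ (q, k))] := hC (pickle (q, k)); rewrite pickleK => /(_ erefl).
case; first by exists y.
move=> _ /= Cq.
have -> : C (pickle (q, k)) - y = (C (pickle (q, k)) - map_mx ratr q) - (y - map_mx ratr q).
  by rewrite opprB addrA subrK.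
apply: le_lt_trans (ler_normB _ _) _; rewrite [ltRHS]splitr.
by apply: ltrD; [exact: lt_trans Cq ke|exact: lt_trans yq ke].
Qed.

(** Otherwise [u] is at least [e] from rank [N] on, and the weighted series
    dominates [e] times a divergent one. *)
Lemma series_lt_infty_small (g u : nat -> R) (B : R) :
  (forall k, 0 < g k) -> (\sum_(0 <= k <oo) (g k)%:E = +oo)%E ->
  (forall k, series (fun j => g j * u j) k <= B) ->
  forall (e : R) (N : nat), 0 < e -> (forall k, 0 <= u k) ->
  exists2 k, (N <= k)%N & u k < e.
Proof.
move=> g0 goo gB e N e0 u0; apply: contrapT => h.
have ue k : (N <= k)%N -> e <= u k.
  by move=> Nk; rewrite leNgt; apply/negP => uk; apply: h; exists k.
have : (\sum_(0 <= k <oo) (g k)%:E <= (series g N + B / e)%:E)%E.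
  apply: lime_le; first by apply: is_cvg_nneseries => k _ _; rewrite lee_fin ltW.
  apply: nearW => k; rewrite sumEFin lee_fin.
  have [Nk|kN] := leqP N k; last first.
    rewrite /series/= (big_cat_nat (leq0n k) (ltnW kN))/= -addrA lerDl addr_ge0//.
      by rewrite sumr_ge0// => j _; exact: ltW.
    by rewrite divr_ge0 ?(ltW e0)// (le_trans _ (gB 0%N))// /series/= big_geq.
  rewrite (big_cat_nat (leq0n N) Nk)/= lerD2l ler_pdivlMr// mulr_suml.
  apply: le_trans (gB k); rewrite /series/= (big_cat_nat (leq0n N) Nk)/=.
  rewrite ler_wpDl//; first by rewrite sumr_ge0// => j _; rewrite mulr_ge0// ltW.
  rewrite big_nat [leRHS]big_nat; apply: ler_sum => j /andP[Nj _].
  by rewrite ler_pM2l// ue.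
by rewrite goo leye_eq.
Qed.

(** The sequence is bounded and [H] tends to its minimum along a subsequence; any
    cluster point [X] of that subsequence is a minimizer. The distances to the points
    of [C] close to [X] converge, and their limits are small since [X] is a cluster
    point. *)
Lemma quasi_fejer_cvg (H : 'rV[R]_n -> R) (C : nat -> 'rV[R]_n)
    (x : nat -> 'rV[R]_n) (g : nat -> R) :
  slope_bounded H ->
  (forall m, minimizer H (C m)) ->
  (forall y (e : R), minimizer H y -> 0 < e -> exists m, `|C m - y| < e) ->
  (forall k, 0 < g k) -> (\sum_(0 <= k <oo) (g k)%:E = +oo)%E ->
  (forall m, cvgn (fun k => sqnorm (x k - C m))) ->
  (forall r : nat, exists B : R, forall k,
     series (fun j => g j * (ray_increment r.+1%:R (C 0%N) H (x j)
       / (1 + sqnorm (x j - C 0%N)))) k <= B) ->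
  exists X, minimizer H X /\ x @ \oo --> X.
Proof.
move=> sH minC denseC g0 goo cD rB; set C0 := C 0%N.
have [M DM] := cvgn_bounded (cD 0%N); rewrite -/C0 in DM.
have M0 : 0 <= M by exact: le_trans (DM 0%N).
have xM k : `|x k - C0| <= 1 + M.
  apply: le_trans (norm_le1Dsqnorm _) _; rewrite lerD2l.
  by apply: le_trans (DM k); exact: ler_norm.
have [r rM] : exists r : nat, 1 + M <= r.+1%:R.
  by exists (Num.trunc (1 + M)); rewrite ltW// truncnS_gt.
have [B gB] := rB r; rewrite -/C0 in gB.
have r0 : 0 < r.+1%:R :> R by [].
(* for the radius r.+1 the increments along the sequence are the true ones *)
have lowH k (e : R) : 0 < e -> exists2 j, (k <= j)%N & H (x j) < H C0 + e.
  move=> e0; have D0 j : 0 < 1 + sqnorm (x j - C0).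
    by rewrite ltr_wpDr ?sqnorm_ge0.
  have eM0 : 0 < e / (1 + M) by rewrite divr_gt0// ltr_wpDr.
  have [|j kj] := series_lt_infty_small g0 goo gB (e := e / (1 + M)) k eM0.
    by move=> j; rewrite divr_ge0 ?(ltW (D0 j))//; apply: ray_increment_ge0 => //; exact: minC.
  rewrite ray_increment_in ?(le_trans (xM j))//.
  rewrite ltr_pdivrMr// mulrAC ltr_pdivlMr; last by rewrite ltr_wpDr.
  move=> h; exists j => //; rewrite -ltrBlDl.
  have : H (x j) - H C0 < e \/ e <= H (x j) - H C0 by case: ltP; [left|right].
  case=> // eH.
  have D1M : 1 + sqnorm (x j - C0) <= 1 + M.
    by rewrite lerD2l; apply: le_trans (DM j); exact: ler_norm.
  have M1 : 0 < 1 + M by rewrite ltr_wpDr.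
  by have := D0 j; nra.
have /choice[f hf] : forall k, exists j, (k <= j)%N /\ H (x j) < H C0 + k.+1%:R^-1.
  by move=> k; have [|j kj Hj] := lowH k k.+1%:R^-1; [rewrite invr_gt0|exists j].
pose ball := [set z : 'rV[R]_n | `|z - C0| <= 1 + M].
have cball : compact ball by exact: compact_norm_ball.
have [X Xcl] : exists X : 'rV[R]_n, cluster ((fun k => x (f k)) @ \oo) X.
  have [|X [_ Xcl]] := cball ((fun k => x (f k)) @ \oo) _; last by exists X.
  by exists 0%N => // k _; exact: xM.
have freq (e : R) N : 0 < e ->
    exists k, [/\ (N <= k)%N, `|x k - X| < e & H (x k) < H C0 + e].
  move=> e0.
  have [K _ /(_ _ (leqnn _))/= Ke] := near_infty_natSinv_lt (PosNum e0).
  have [||z [[k /= Nk <-] Xk]] := Xcl [set x (f k) | k in [set k | (maxn N K <= k)%N]]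
     [set z | `|z - X| < e].
  - by exists (maxn N K) => // k ?; exists k.
  - apply: filterS (nbhsx_ballx X _ e0) => z; rewrite mx_norm_ball /ball_/= distrC.
    exact.
  move: Nk; rewrite geq_max => /andP[Nk Kk].
  exists (f k); split => //; first exact: leq_trans Nk (hf k).1.
  apply: lt_le_trans (hf k).2 _; rewrite lerD2l; apply: le_trans (ltW Ke).
  by rewrite lef_pV2 ?posrE// ler_nat ltnS.
have minX : minimizer H X.
  move=> y; apply: le_trans (minC 0%N y); rewrite -/C0.
  have [K K0 HK] := sH `|X|; apply/ler_addgt0Pr => e e0.
  have K1 : 0 < 1 + K by rewrite ltr_wpDr.
  have [k [_ kX Hk]] := freq (e / (1 + K)) 0%N (divr_gt0 e0 K1).
  have := HK X (x k) (lexx _).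
  have : K * `|x k - X| <= K * (e / (1 + K)) by rewrite ler_wpM2l// ltW.
  have : e / (1 + K) + K * (e / (1 + K)) = e by field; rewrite gt_eqF.
  lra.
exists X; split=> //.
suff near_lt (e : R) : 0 < e -> \forall k \near \oo, `|X - x k| < e.
  exact/cvgrPdist_lt.
move=> e0.
(* the factor n relates the two norms; the distance to C m is at most (2 n + 1) eta *)
pose eta : R := e / (2 * n%:R + 2).
have n0 : 0 <= n%:R :> R by [].
have eta0 : 0 < eta by rewrite divr_gt0//; lra.
have [m CmX] := denseC X eta minX eta0.
have [l Dl] : exists l : R, (fun k => sqnorm (x k - C m)) @ \oo --> l.
  exact/cvg_ex/cD.
have eta20 : 0 < eta ^+ 2 / 2 by rewrite divr_gt0// exprn_gt0.
have [N _ hN] := (cvgrPdist_lt _ _).1 Dl _ eta20.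
have [k0 [Nk0 k0X _]] := freq eta N eta0.
have lle : l < 4 * n%:R * eta ^+ 2 + eta ^+ 2 / 2.
  have := hN _ Nk0; rewrite /= ltr_norml => /andP[_].
  have := sqnorm_le_sqr_norm (x k0 - C m).
  suff : n%:R * `|x k0 - C m| ^+ 2 <= n%:R * (2 * eta) ^+ 2 by lra.
  rewrite ler_wpM2l// lerXn2r ?nnegrE//; first by rewrite mulr_ge0// ltW.
  have -> : x k0 - C m = (x k0 - X) - (C m - X) by rewrite opprB addrA subrK.
  by rewrite (le_trans (ler_normB _ _))//; lra.
exists N => // k /= Nk; have := hN _ Nk; rewrite /= ltr_norml => /andP[hk _].
have : `|x k - C m| < (2 * n%:R + 1) * eta.
  rewrite -(@ltr_pXn2r _ 2)// ?nnegrE//; last by rewrite mulr_ge0 ?ltW//; lra.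
  apply: le_lt_trans (sqr_norm_le_sqnorm _) _.
  apply: (@lt_le_trans _ _ (4 * n%:R * eta ^+ 2 + eta ^+ 2)); first by lra.
  have : 0 <= n%:R * n%:R * eta ^+ 2 by rewrite !mulr_ge0// ltW.
  lra.
move=> xC; apply: (@le_lt_trans _ _ (`|C m - X| + `|x k - C m|)).
  have -> : X - x k = (X - C m) - (x k - C m) by rewrite opprB addrA subrK.
  by rewrite (distrC (C m)) ler_normB.
have eE : eta + (2 * n%:R + 1) * eta = e.
  by rewrite /eta; field; rewrite gt_eqF//; lra.
by rewrite -[ltRHS]eE; apply: ltrD.
Qed.

End Deterministic.

(** * Almost sure convergence of incremental methods *)

Lemma uniform_constant (R : realType) (S : eqType) (l : seq S) (Q : S -> R -> Prop) :
  (forall s K K', K <= K' -> Q s K -> Q s K') ->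
  (forall s, s \in l -> exists2 K : R, 0 <= K & Q s K) ->
  exists2 K : R, 0 <= K & forall s, s \in l -> Q s K.
Proof.
move=> mono; elim: l => [_|a l ih lQ]; first by exists 0.
have [K K0 aK] := lQ a (mem_head _ _).
have [K' K'0 lK'] := ih (fun s sl => lQ s (mem_behead (s := a :: l) sl)).
exists (Num.max K K') => [|s]; first by rewrite le_max K0.
rewrite inE => /predU1P[->|/lK']; first by apply: mono aK; rewrite le_max lexx.
by apply: mono; rewrite le_max lexx orbT.
Qed.

(** Slopes and weights depend on the sample and on the position in the pass; this
    turns them into constants of the algorithm. *)
Lemma uniform_constant2 (R : realType) (S : eqType) (l : seq S) (L : nat)
    (Q : S -> nat -> R -> Prop) :
  (forall s i K K', K <= K' -> Q s i K -> Q s i K') ->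
  (forall s i, s \in l -> (i < L)%N -> exists2 K : R, 0 <= K & Q s i K) ->
  exists2 K : R, 0 <= K & forall s i, s \in l -> (i < L)%N -> Q s i K.
Proof.
move=> mono lQ.
have [K K0 hK] : exists2 K : R, 0 <= K &
    forall s, s \in l -> forall i, (i < L)%N -> Q s i K.
  apply: uniform_constant => [s K K' KK' sK i iL|s sl]; first exact: mono (sK i iL).
  have [K K0 hK] : exists2 K : R, 0 <= K & forall i, i \in iota 0 L -> Q s i K.
    apply: uniform_constant => [i|i]; first exact: mono.
    by rewrite mem_iota => /andP[_]; exact: lQ.
  by exists K => // i iL; apply: hK; rewrite mem_iota.
by exists K => // s i sl; exact: hK.
Qed.

Section StochasticIteration.
Context {R : realType} {d : measure_display} {T : measurableType d} (P : probability T R).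
Variables (S : countType) (s0 : S) (eta : nat -> T -> S) (p : S -> R) (supp : seq S).
Hypothesis eta_meas : forall k (A : set S), measurable (eta k @^-1` A).
Hypothesis p_ge0 : forall s, 0 <= p s.
Hypothesis p_sum : \sum_(s <- supp) p s = 1.
Hypothesis eta_supp : forall k, P (eta k @^-1` [set s | s \notin supp]) = 0%E.
Hypothesis cylinderS : forall N u,
  Pr P (cylinder eta N.+1 u) = Pr P (cylinder eta N u) * p (u N).

Variables (n : nat) (step : R -> S -> 'rV[R]_n -> 'rV[R]_n).
Variables (h : S -> 'rV[R]_n -> R) (g : nat -> R) (x0 : 'rV[R]_n).

Fixpoint iteration (u : nat -> S) (k : nat) : 'rV[R]_n :=
  if k is k'.+1 then step (g k') (u k') (iteration u k') else x0.

Definition mean_cost (x : 'rV[R]_n) : R := \sum_(s <- supp) p s * h s x.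

Hypothesis h_convex : {in supp, forall s, convex_function setT (h s)}.
Hypothesis h_slope : {in supp, forall s, slope_bounded (h s)}.
Hypothesis g_gt0 : forall k, 0 < g k.
Hypothesis g_sum : (\sum_(0 <= k <oo) (g k)%:E = +oo)%E.
Hypothesis g_sum2 : cvgn (series (fun k => g k ^+ 2)).
Hypothesis step_le : forall (r : R) xs, 0 < r -> minimizer mean_cost xs ->
  exists c0 K : R, [/\ 0 < c0, 0 <= K & forall c s x, 0 < c <= c0 -> s \in supp ->
    sqnorm (step c s x - xs) <= sqnorm (x - xs)
      - 2 * c * ray_increment r xs (h s) x + K * c ^+ 2].

Lemma iteration_det k : determined k (iteration^~ k).
Proof.
move=> u u'; elim: k => [//|k ih] uu' /=.
have -> : iteration u k = iteration u' k.
  by apply: ih => j jk; apply: uu'; exact: ltnW.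
by rewrite uu'.
Qed.

Lemma iteration_update_at u k s : iteration (update_at u k s) k = iteration u k.
Proof. by apply: (@iteration_det k (update_at u k s) u) => j jk; rewrite /update_at ltn_eqF. Qed.

Lemma mean_cost_slope_bounded : slope_bounded mean_cost.
Proof.
by apply: slope_bounded_sum => s ss; apply: slope_boundedZ => //; exact: h_slope.
Qed.

Lemma small_steps (c0 : R) : 0 < c0 -> \forall k \near \oo, g k <= c0.
Proof.
move=> c00; have := cvg_series_cvg_0 g_sum2 => /cvgrPdist_lt/(_ _ (exprn_gt0 2 c00)).
apply: filterS => k; rewrite sub0r normrN ger0_norm ?sqr_ge0//.
by move=> /ltW; rewrite ler_pXn2r ?nnegrE ?(ltW c00) ?(ltW (g_gt0 k)).
Qed.

(** The square distances to a minimizer satisfy the recursion of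
    [cvgn_log_decrease], whose perturbation is the sum of a bounded martingale increment
    (after division by [1 + sqnorm (x - xs)], which dominates the linear growth of
    [ray_increment]) and of a multiple of [g k ^+ 2]. *)
Lemma iteration_fejer (r : R) xs : 0 < r -> minimizer mean_cost xs ->
  {ae P, forall w, cvgn (fun k => sqnorm (iteration (trajectory eta w) k - xs)) /\
    exists B : R, forall k, series (fun j => g j *
      (ray_increment r xs mean_cost (iteration (trajectory eta w) j)
       / (1 + sqnorm (iteration (trajectory eta w) j - xs)))) k <= B}.
Proof.
move=> r0 xs_min; have [c0 [K [c00 K0 stepK]]] := step_le r0 xs_min.
pose q s x := ray_increment r xs (h s) x; pose e x := ray_increment r xs mean_cost x.
pose D x := 1 + sqnorm (x - xs).
have D1 x : 1 <= D x by rewrite lerDl sqnorm_ge0.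
have D0 x : 0 < D x by exact: lt_le_trans ltr01 (D1 x).
have [Q Q0 qQ] : exists2 Q : R, 0 <= Q &
    forall s, s \in supp -> forall x, `|q s x| <= Q * D x.
  apply: uniform_constant => [s Q Q' QQ' sQ x|s ss].
    by apply: le_trans (sQ x) _; rewrite ler_wpM2r// ltW.
  have [Q Q0 [qQ _]] := ray_increment_bounds xs r0 (h_convex ss) (h_slope ss).
  exists Q => // x; apply: le_trans (qQ x) _.
  by rewrite ler_wpM2l// norm_le1Dsqnorm.
have eE x : e x = \sum_(s <- supp) p s * q s x by exact: ray_increment_sum.
have eQ x : `|e x| <= Q * D x.
  rewrite eE; apply: le_trans (ler_norm_sum _ _ _) _.
  rewrite -[leRHS]mul1r -p_sum mulr_suml big_seq [leRHS]big_seq.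
  by apply: ler_sum => s ss; rewrite normrM ger0_norm// ler_wpM2l// qQ.
pose c k u := g k * ((q (u k) (iteration u k) - e (iteration u k)) / D (iteration u k)).
have c_det k : determined k.+1 (c k).
  move=> u u' uu'; have XE : iteration u k = iteration u' k.
    by apply: (@iteration_det k u u') => j jk; apply: uu'; exact: ltnW.
  by rewrite /c XE uu'.
have c_mean0 k u : \sum_(s <- supp) p s * c k (update_at u k s) = 0.
  under eq_bigr do rewrite /c iteration_update_at /update_at eqxx mulrCA [p _ * _]mulrA.
  rewrite -mulr_sumr -mulr_suml; under eq_bigr do rewrite mulrBr.
  by rewrite sumrB -eE -mulr_suml p_sum mul1r subrr mul0r mulr0.
have c_bound k u : u k \in supp -> `|c k u| <= 2 * Q * g k.
  move=> us; rewrite normrM gtr0_norm// mulrC ler_pM2r//.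
  rewrite normrM normfV (gtr0_norm (D0 _)) ler_pdivrMr//.
  apply: le_trans (ler_normB _ _) _; rewrite -mulrA mulrDl mul1r.
  by rewrite lerD ?qQ.
have b_sum2 : cvgn (series (fun k => (2 * Q * g k) ^+ 2)).
  rewrite (_ : (fun _ => _) = (2 * Q) ^+ 2 *: (fun k => g k ^+ 2)).
    exact: is_cvg_seriesZ.
  by apply/funext => k; rewrite exprMn.
have mcvg := martingale_series_cvg s0 eta_meas p_ge0 p_sum eta_supp cylinderS
  c_det c_mean0 c_bound b_sum2.
have supp_ae : {ae P, forall w, forall k, eta k w \in supp}.
  apply: ae_foralln => k; exists (eta k @^-1` [set s | s \notin supp]); split.
  - exact: eta_meas.
  - exact: eta_supp.
  - by move=> w /= /negP.
apply: filterS2 mcvg supp_ae => w cw ws.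
set X := iteration (trajectory eta w).
have decr : \forall k \near \oo, D (X k.+1) <= D (X k) *
   (1 + (K * g k ^+ 2 - 2 * c k (trajectory eta w)) - 2 * (g k * (e (X k) / D (X k)))).
  apply: filterS (small_steps c00) => k gk.
  have := stepK (g k) (trajectory eta w k) (X k); rewrite g_gt0 gk => /(_ isT (ws k)).
  rewrite -/(iteration _ _) -/(q _ _) => st.
  have -> : D (X k) * (1 + (K * g k ^+ 2 - 2 * c k (trajectory eta w))
      - 2 * (g k * (e (X k) / D (X k)))) =
    D (X k) + D (X k) * (K * g k ^+ 2) - 2 * g k * q (trajectory eta w k) (X k).
    by rewrite /c -/X; field; rewrite gt_eqF.
  have Kg : 0 <= K * g k ^+ 2 by rewrite mulr_ge0// sqr_ge0.
  have := ler_peMl Kg (D1 (X k)); rewrite /D /= in st *; lra.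
have [|||cD [B eB]] := cvgn_log_decrease _ _ decr.
- by move=> k; exact: D1.
- move=> k; rewrite mulr_ge0// mulr_ge0 ?(ltW (g_gt0 _))//.
  by rewrite divr_ge0 ?(ltW (D0 _))//; exact: ray_increment_ge0 r0 xs_min.
- rewrite (_ : (fun _ => _) =
      K *: (fun k => g k ^+ 2) - 2 *: (fun k => c k (trajectory eta w))); last first.
    by apply/funext.
  by apply: is_cvg_seriesB; apply: is_cvg_seriesZ.
split.
  rewrite (_ : (fun _ => _) = (fun k => D (X k) - 1)); last first.
    by apply/funext => k; rewrite /D addrAC subrr add0r.
  by apply: is_cvgB => //; exact: is_cvg_cst.
exists (B / 2) => k; have := eB k; rewrite ler_pdivlMr// mulrC; apply: le_trans.
rewrite /series/= mulr_sumr; exact: lexx.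
Qed.

Theorem iteration_cvg : (exists x, minimizer mean_cost x) ->
  {ae P, forall w, exists X, minimizer mean_cost X /\
    iteration (trajectory eta w) @ \oo --> X}.
Proof.
move=> exmin.
have [C minC denseC] := countable_dense_subset exmin.
have fejer : {ae P, forall w, forall m r : nat,
    cvgn (fun k => sqnorm (iteration (trajectory eta w) k - C m)) /\
    exists B : R, forall k, series (fun j => g j *
      (ray_increment r.+1%:R (C m) mean_cost (iteration (trajectory eta w) j)
       / (1 + sqnorm (iteration (trajectory eta w) j - C m)))) k <= B}.
  by apply: ae_foralln => m; apply: ae_foralln => r; exact: iteration_fejer.
apply: filterS fejer => w fw.
apply: (quasi_fejer_cvg mean_cost_slope_bounded minC _ g_gt0 g_sum).
- by move=> y e ymin e0; exact: denseC.
- by move=> m; exact: (fw m 0%N).1.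
- by move=> r; exact: (fw 0%N r).2.
Qed.

End StochasticIteration.

(** * Cutting a walk into simple paths *)

Section Tiling.
Variables (V : finType) (E : {set {set V}}) (L : nat) (u : nat -> V).
Hypothesis hE : simple_graph E.
Hypothesis u_edge : forall k, (k < L)%N -> [set u k; u k.+1]%SET \in E.

Lemma edge_neq (a b : V) : [set a; b]%SET \in E -> a != b.
Proof. by move=> /hE; rewrite cards2; case: (a != b). Qed.

Lemma next_time_ge t k : next_time u t = Some k -> (t <= k)%N.
Proof.
rewrite /next_time; case: pselect => // ex [<-].
by case: ex_minnP => m /andP[].
Qed.

(** The vertex visited at time [t] differs from the previous one, an edge being a
    set of two vertices. *)
Lemma next_time_gt t k : (0 < t <= L)%N -> next_time u t = Some k -> (t < k)%N.
Proof.
move=> /andP[t0 tL] nt; have := next_time_ge nt; rewrite leq_eqVlt => /predU1P[tk|//].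
move: nt; rewrite /next_time; case: pselect => // ex [<-].
case: ex_minnP => m /andP[]; rewrite leq_eqVlt => /predU1P[<-|//].
have -> : index_iota t.-1 t = [:: t.-1] by rewrite /index_iota -[in (t - _)%N](prednK t0) subSnn.
rewrite inE => /eqP ut _; have := u_edge (k := t.-1); rewrite prednK// => /(_ tL).
by move=> /edge_neq; rewrite ut eqxx.
Qed.

Lemma tau_ge i t : tau u i = Some t -> (0 < t)%N && (minn i.+1 L.+1 <= t)%N.
Proof.
elim: i t => [|i ih] k /=; first by move=> [<-]; lia.
case E' : (tau u i) => [t|//] /= nt; have := ih _ E' => /andP[t0 it].
have tk := next_time_ge nt.
have [tL|Lt] := leqP t L; last by lia.
by have := next_time_gt _ nt; rewrite t0 tL => /(_ isT); lia.
Qed.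

Lemma cut_time0 : cut_time L u 0 = 1%N.
Proof. by rewrite /cut_time /=; lia. Qed.

Lemma cut_time_le i : (cut_time L u i <= L.+1)%N.
Proof. by rewrite /cut_time; case: tau => [t|]; lia. Qed.

Lemma cut_time_gt0 i : (0 < cut_time L u i)%N.
Proof. by rewrite /cut_time; case E' : tau => [t|//]; have := tau_ge E'; lia. Qed.

Lemma cut_time_homo i : (cut_time L u i <= cut_time L u i.+1)%N.
Proof.
rewrite {2}/cut_time /=; case E' : (tau u i) => [t|] /=; last exact: cut_time_le.
rewrite /cut_time E'; case nt : (next_time u t) => [k|]; last by lia.
by have := next_time_ge nt; lia.
Qed.

Lemma cut_time_last : cut_time L u L = L.+1.
Proof. by rewrite /cut_time; case E' : tau => [t|//]; have := tau_ge E'; lia. Qed.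

(** The cut times increase by at least one until they reach [L.+1], so the [L] paths
    tile the steps [0], ..., [L.-1]. *)
Lemma sum_cut_time (R : nmodType) (f : nat -> R) :
  \sum_(i < L) \sum_((cut_time L u i).-1 <= k < (cut_time L u i.+1).-1) f k =
  \sum_(0 <= k < L) f k.
Proof.
suff h m : \sum_(i < m) \sum_((cut_time L u i).-1 <= k < (cut_time L u i.+1).-1) f k =
    \sum_(0 <= k < (cut_time L u m).-1) f k by rewrite h cut_time_last.
elim: m => [|m ih]; first by rewrite big_ord0 cut_time0 big_geq.
rewrite big_ord_recr /= ih -big_cat_nat//.
by have := cut_time_homo m; lia.
Qed.

Lemma zip_behead_iota a m :
  let s := [seq u k | k <- iota a m.+1] in
  zip s (behead s) = [seq (u k, u k.+1) | k <- iota a m].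
Proof. by elim: m a => [|m ih] a //=; congr cons; exact: ih. Qed.

Lemma size_simple_path i :
  size (simple_path L u i.+1) = ((cut_time L u i.+1).-1 - (cut_time L u i).-1).+1.
Proof.
rewrite /simple_path size_map size_iota /=.
have := cut_time_homo i; have := cut_time_gt0 i; have := cut_time_gt0 i.+1; lia.
Qed.

Lemma zip_simple_path i :
  let s := simple_path L u i.+1 in zip s (behead s) =
  [seq (u k, u k.+1) | k <- index_iota (cut_time L u i).-1 (cut_time L u i.+1).-1].
Proof.
rewrite /= -zip_behead_iota /simple_path /index_iota.
congr (zip (map _ (iota _ _)) (behead (map _ (iota _ _)))) => /=;
have := cut_time_homo i; have := cut_time_gt0 i; have := cut_time_gt0 i.+1; lia.
Qed.

Lemma simple_path_edges i :
  let s := simple_path L u i.+1 in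
  all (fun q => [set q.1; q.2]%SET \in E) (zip s (behead s)).
Proof.
rewrite /= zip_simple_path all_map; apply/allP => k /=.
rewrite mem_index_iota => /andP[_ kc]; apply: u_edge.
by have := cut_time_le i.+1; lia.
Qed.

End Tiling.

Lemma nth_split_paths (V : finType) (L : nat) (u : nat -> V) i : (i < L)%N ->
  nth [::] (split_paths L u) i = simple_path L u i.+1.
Proof.
by move=> iL; rewrite -(tnth_nth _ _ (Ordinal iL)) tnth_mktuple.
Qed.

(** * The law of a step of the stationary walk *)

Section FiniteMean.
Context {R : realType} {d : measure_display} {T : measurableType d} (P : probability T R).

Definition finite_rv (I : eqType) (l : seq I) (Y : T -> I) : Prop :=
  [/\ uniq l, forall w, Y w \in l & forall i, measurable (Y @^-1` [set i])].

Definition mean (I : eqType) (l : seq I) (Y : T -> I) (f : I -> R) : R :=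
  \sum_(i <- l) Pr P (Y @^-1` [set i]) * f i.

Lemma Pr_partition (I : eqType) (l : seq I) (Y : T -> I) A :
  finite_rv l Y -> measurable A ->
  Pr P A = \sum_(i <- l) Pr P (A `&` Y @^-1` [set i]).
Proof.
move=> [ul Yl mY] mA.
suff h (l' : seq I) : uniq l' ->
    measurable (A `&` [set w | Y w \in l']) /\
    Pr P (A `&` [set w | Y w \in l']) =
    \sum_(i <- l') Pr P (A `&` Y @^-1` [set i]).
  rewrite -(h l ul).2; congr (Pr _ _); apply/seteqP; split => [w Aw|w []//].
  by split => //=.
elim: l' => [_|i l' ih /= /andP[il' /ih[mI sumI]]].
  by rewrite big_nil [A `&` _](_ : _ = set0) ?Pr_set0//; apply/seteqP; split => w// [].
have -> : A `&` [set w | Y w \in i :: l'] =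
    (A `&` Y @^-1` [set i]) `|` (A `&` [set w | Y w \in l']).
  apply/seteqP; split => w /=.
    by rewrite inE => -[Aw /predU1P[|]]; [left|right].
  by rewrite inE => -[[Aw ->]|[Aw ->]]; rewrite ?eqxx ?orbT.
have mi : measurable (A `&` Y @^-1` [set i]) by exact: measurableI.
split; first exact: measurableU.
rewrite PrU// ?big_cons ?sumI//.
by apply/seteqP; split => // w [[_ /= ->] [_]]; rewrite (negbTE il').
Qed.

(** Refine by the joint values of [Y] and [Z]: those of positive probability are
    attained on [G]. *)
Lemma mean_eq (I J : eqType) (l : seq I) (l' : seq J) Y Z f g (G : set T) :
  finite_rv l Y -> finite_rv l' Z -> measurable G -> Pr P (~` G) = 0 ->
  (forall w, G w -> f (Y w) = g (Z w)) -> mean l Y f = mean l' Z g.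
Proof.
move=> hY hZ mG G0 fg; have [_ _ mY] := hY; have [_ _ mZ] := hZ.
rewrite /mean; under eq_bigr => i _ do rewrite (Pr_partition hZ (mY i)) mulr_suml.
under [RHS]eq_bigr => i _ do rewrite (Pr_partition hY (mZ i)) mulr_suml.
rewrite [RHS]exchange_big/=; apply: eq_bigr => i _; apply: eq_bigr => j _.
rewrite [Z @^-1` _ `&` _]setIC; set A := Y @^-1` _ `&` _.
have mA : measurable A by exact: measurableI.
have [[w [[/= <- <-] Gw]]|nAG] := pselect (exists w, (A `&` G) w).
  by rewrite fg.
suff -> : Pr P A = 0 by rewrite !mul0r.
apply/eqP; rewrite eq_le Pr_ge0 andbT -G0; apply: le_Pr => //; first exact: measurableC.
by move=> w Aw Gw; apply: nAG; exists w.
Qed.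

Lemma mean_sum (I : eqType) (l : seq I) Y (K : Type) (r : seq K) (f : K -> I -> R) :
  mean l Y (fun i => \sum_(k <- r) f k i) = \sum_(k <- r) mean l Y (f k).
Proof.
rewrite /mean exchange_big/=; apply: eq_bigr => i _; by rewrite mulr_sumr.
Qed.

End FiniteMean.

Section EdgeSum.
Variables (R : numFieldType) (V : finType) (E : {set {set V}}).
Hypothesis hE : simple_graph E.

(** Each edge is counted twice, once for each orientation. *)
Lemma sum_oriented_edges (f : V -> V -> R) :
  (forall a b, [set a; b]%SET \in E -> f a b = f b a) ->
  \sum_(q : V * V) ([set q.1; q.2]%SET \in E)%:R * f q.1 q.2 =
  2 * \sum_(e in E) if enum e is [:: i; j] then f i j else 0.
Proof.
move=> fsym.
have -> : \sum_(q : V * V) ([set q.1; q.2]%SET \in E)%:R * f q.1 q.2 =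
    \sum_(q : V * V | [set q.1; q.2]%SET \in E) f q.1 q.2.
  rewrite [RHS]big_mkcond; apply: eq_bigr => q _.
  by case: ifP => _; rewrite ?mul1r ?mul0r.
rewrite (partition_big (fun q : V * V => [set q.1; q.2]%SET) (mem E))//= mulr_sumr.
apply: eq_bigr => e eE; have := hE eE; rewrite cardE.
have : uniq (enum e) by exact: enum_uniq.
have e_mem x : (x \in e) = (x \in enum e) by rewrite mem_enum.
case: (enum e) e_mem => [|i [|j []]]// e_mem /=; rewrite inE andbT => ij _.
have eij : e = [set i; j]%SET by apply/setP => x; rewrite e_mem !inE.
rewrite (bigD1 (i, j))/=; last by rewrite -eij eE eqxx.
rewrite (bigD1 (j, i))/=; last first.
  by rewrite finset.setUC -eij eE eqxx/= xpair_eqE negb_and eq_sym ij.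
rewrite big1 => [|[a b] /=].
  by rewrite addr0 (fsym i j) -?eij//; ring.
move=> /andP[/andP[/andP[_ /eqP abe]]]; rewrite eij in abe.
have ae : a \in [set i; j]%SET by rewrite -abe !inE eqxx.
have be : b \in [set i; j]%SET by rewrite -abe !inE eqxx orbT.
have ie : i \in [set a; b]%SET by rewrite abe !inE eqxx.
have je : j \in [set a; b]%SET by rewrite abe !inE eqxx orbT.
move: ae be ie je; rewrite !inE !xpair_eqE.
move=> /orP[]/eqP -> /orP[]/eqP ->; rewrite ?eqxx ?orbF ?orbb//= => h1 h2.
  by move: ij; rewrite eq_sym h2.
by move: ij; rewrite h1.
Qed.

End EdgeSum.

Section Chain.
Context {R : realType} {d : measure_display} {T : measurableType d} (P : probability T R).
Variables (V : finType) (E : {set {set V}}) (v : nat -> T -> V).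
Hypothesis hE0 : (0 < #|E|)%N.
Hypothesis v_chain : markov_chain E P v.

Lemma chain_meas k (A : set V) : measurable (v k @^-1` A).
Proof. by case: v_chain. Qed.

Definition history (n : nat) (w : T) : {ffun 'I_n.+1 -> V} := [ffun j : 'I_n.+1 => v j w].

Lemma history_rv n : finite_rv (index_enum {ffun 'I_n.+1 -> V}) (history n).
Proof.
split=> [|w|t]; [exact: index_enum_uniq|exact: mem_index_enum|].
have -> : history n @^-1` [set t] = \bigcap_(j in [set: 'I_n.+1]) (v j @^-1` [set t j]).
  apply/seteqP; split => w /=.
    by move=> <- j _ /=; rewrite ffunE.
  by move=> h; apply/ffunP => j; rewrite ffunE; exact: h.
by apply: fin_bigcap_measurable => // j _; exact: chain_meas.
Qed.

Lemma pair_rv k : finite_rv (index_enum (V * V)%type) (fun w => (v k w, v k.+1 w)).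
Proof.
split=> [|w|[a b]]; [exact: index_enum_uniq|exact: mem_index_enum|].
rewrite (_ : _ @^-1` _ = v k @^-1` [set a] `&` v k.+1 @^-1` [set b]).
  by apply: measurableI; exact: chain_meas.
by apply/seteqP; split => w /= [-> ->].
Qed.

(** The Markov property is given along whole histories; sum it over the histories
    that end in [a]. *)
Lemma chain_step k a b :
  Pr P (v k @^-1` [set a] `&` v k.+1 @^-1` [set b]) =
  Pr P (v k @^-1` [set a]) * kernel_matrix R E a b.
Proof.
have mI : measurable (v k @^-1` [set a] `&` v k.+1 @^-1` [set b]).
  by apply: measurableI; exact: chain_meas.
rewrite (Pr_partition P (history_rv k) mI) (Pr_partition P (history_rv k) (chain_meas k [set a])).
rewrite mulr_suml; apply: eq_bigr => t _.
have [ta|ta] := eqVneq (t ord_max) a; last first.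
  have h A : v k @^-1` [set a] `&` A `&` history k @^-1` [set t] = set0.
    apply/seteqP; split => // w [[/= va _] wt].
    by move: ta; rewrite -va -wt ffunE eqxx.
  by rewrite h -[v k @^-1` [set a] in RHS]setIT h Pr_set0 mul0r.
pose al j : V := if (j <= k)%N then t (inord j) else b.
have [_ _ /(_ k al)] := v_chain.
have -> : [set w | forall j, (j <= k.+1)%N -> v j w = al j] =
   v k @^-1` [set a] `&` v k.+1 @^-1` [set b] `&` history k @^-1` [set t].
  apply/seteqP; split => w /=.
    move=> h; split; first split.
    - by rewrite h// /al leqnn -ta; congr (t _); apply/val_inj; rewrite /= inordK.
    - by rewrite h// /al ltnn.
    - apply/ffunP => j; rewrite ffunE h; last by rewrite ltnW// ltn_ord.
      by rewrite /al -ltnS ltn_ord inord_val.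
  move=> [[va vb] wt] j; rewrite leq_eqVlt => /predU1P[->|].
    by rewrite vb /al ltnn.
  by rewrite ltnS => jk; rewrite /al jk -wt ffunE inordK.
have -> : [set w | forall j, (j <= k)%N -> v j w = al j] =
   v k @^-1` [set a] `&` history k @^-1` [set t].
  apply/seteqP; split => w /=.
    move=> h; split.
    - by rewrite h// /al leqnn -ta; congr (t _); apply/val_inj; rewrite /= inordK.
    - apply/ffunP => j; rewrite ffunE h; last by rewrite -ltnS ltn_ord.
      by rewrite /al -ltnS ltn_ord inord_val.
  by move=> [va wt] j jk; rewrite /al jk -wt ffunE inordK.
have -> : al k = a.
  by rewrite /al leqnn -ta; congr (t _); apply/val_inj; rewrite /= inordK.
have -> : al k.+1 = b by rewrite /al ltnn.
by move=> /(congr1 fine); rewrite /Pr fineM ?fin_num_measure//;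
  have [_ _ mt] := history_rv k; apply: measurableI => //; exact: chain_meas.
Qed.

Lemma stationary_kernel a b :
  stationary R E a * kernel_matrix R E a b =
  ([set a; b]%SET \in E)%:R / (2 * #|E|%:R).
Proof.
rewrite /stationary /kernel_matrix; case: ifPn => [da|]; last first.
  rewrite -eqn0Ngt => /eqP da; rewrite da !mul0r.
  have [abE|] := boolP ([set a; b]%SET \in E); last by rewrite mul0r.
  by move/eqP: da; rewrite cards_eq0 => /eqP/setP/(_ b); rewrite !inE abE.
by field; rewrite !pnatr_eq0 -!lt0n hE0 da.
Qed.

(** Detailed balance, [stationary_kernel], makes the degree distribution
    invariant. *)
Lemma chain_stationary k a : Pr P (v k @^-1` [set a]) = stationary R E a.
Proof.
elim: k a => [|k ih] a; first by have [_ h _] := v_chain; rewrite /Pr h.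
have v_rv : finite_rv (index_enum V) (v k).
  split=> [|w|i]; [exact: index_enum_uniq|exact: mem_index_enum|exact: chain_meas].
rewrite (Pr_partition P v_rv (chain_meas _ _)).
under eq_bigr => b _ do rewrite setIC chain_step ih stationary_kernel.
rewrite -mulr_suml /stationary; congr (_ / _).
rewrite /deg -sum1_card natr_sum [RHS]big_mkcond/=; apply: eq_bigr => b _.
by rewrite inE finset.setUC; case: ifP.
Qed.

(** The degree in the stationary weight of [a] cancels the one in the kernel, so
    that all oriented edges are equally likely at each step. *)
Lemma pair_law k a b :
  Pr P ((fun w => (v k w, v k.+1 w)) @^-1` [set (a, b)]) =
  ([set a; b]%SET \in E)%:R / (2 * #|E|%:R).
Proof.
rewrite -stationary_kernel -(chain_stationary k) -chain_step; congr (Pr _ _).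
by apply/seteqP; split => w /= [-> ->].
Qed.

Definition walks_on_edges (L : nat) : set T :=
  [set w | forall k, (k < L)%N -> [set v k w; v k.+1 w]%SET \in E].

Lemma walks_on_edges_full L :
  measurable (walks_on_edges L) /\ Pr P (~` walks_on_edges L) = 0.
Proof.
pose B k : set T := [set w | [set v k w; v k.+1 w]%SET \in E].
pose pair k w := (v k w, v k.+1 w).
have mB k : measurable (B k).
  have -> : B k = \bigcup_(q in [set q : V * V | [set q.1; q.2]%SET \in E]) pair k @^-1` [set q].
    apply/seteqP; split => [w Bw|w [q /= qE wq]]; first by exists (pair k w).
    by move: qE; rewrite -wq.
  apply: fin_bigcup_measurable => // q _.
  by have [_ _] := pair_rv k; apply.
have mG : measurable (walks_on_edges L).
  rewrite [walks_on_edges L](_ : _ = \bigcap_(k in [set k | (k < L)%N]) B k) //.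
  by apply: fin_bigcap_measurable => //; exact: finite_II.
split=> //; apply/eqP; rewrite eq_le Pr_ge0 andbT.
pose bad := [seq (k, q) | k <- iota 0 L, q <- enum [pred q : V * V | [set q.1; q.2]%SET \notin E]].
apply: (@le_trans _ _ (\sum_(i <- bad) Pr P (pair i.1 @^-1` [set i.2]))); last first.
  rewrite big_seq big1// => i /allpairsP[[k [a b]] /= [_]].
  by rewrite mem_enum inE /= => qE -> /=; rewrite [Pr _ _]pair_law (negbTE qE) mul0r.
apply: (@Pr_cover_le _ _ _ P _ bad _ set0) => //; first exact: measurableC.
  by move=> i; have [_ _] := pair_rv i.1; apply.
move=> w /= /existsNP[k /not_implyP[kL /negP kE]]; right; exists (k, pair k w) => //=.
by apply/allpairsP; exists (k, pair k w); split => //=; rewrite ?mem_iota ?mem_enum.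
Qed.

End Chain.

Section SplitDetermined.
Variables (V : finType) (L : nat).

Let cap (o : option nat) : nat := if o is Some k then minn k L.+1 else L.+1.

(** Truncation at [L.+1] turns the unbounded search for the next cut time into a
    bounded one, which sees the first [L.+1] vertices only. *)
Lemma next_time_find (u : nat -> V) t :
  cap (next_time u t) = find (revisits u t) (iota 0 L.+1).
Proof.
have none_before (h : forall k, (k <= L)%N -> ~~ revisits u t k) :
    find (revisits u t) (iota 0 L.+1) = L.+1.
  have nh : ~~ has (revisits u t) (iota 0 L.+1).
    by apply/hasPn => k; rewrite mem_iota add0n => /andP[_ /h].
  by rewrite (hasNfind nh) size_iota.
rewrite /next_time; case: pselect => [ex|nex]; last first.
  by rewrite none_before// => k _; apply/negP => rk; apply: nex; exists k.
case: ex_minnP => m rm m_min; rewrite /cap.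
have [mL|Lm] := leqP m L; last first.
  rewrite none_before; first by lia.
  by move=> k kL; apply/negP => /m_min; lia.
have r_m : revisits u t (nth 0%N (iota 0 L.+1) m) by rewrite nth_iota.
have hasr : has (revisits u t) (iota 0 L.+1).
  by apply/hasP; exists m => //; rewrite mem_iota; lia.
have fs := hasr; rewrite has_find size_iota in fs.
have := nth_find 0%N hasr; rewrite nth_iota// add0n => /m_min mf.
have : (find (revisits u t) (iota 0 L.+1) <= m)%N.
  by rewrite leqNgt; apply/negP => /(before_find 0%N); rewrite r_m.
lia.
Qed.

(** Although the times [tau] look at the whole trajectory, their truncations do
    not, which makes the sample a random variable with finitely many values. *)
Lemma split_paths_det : determined L.+1 (@split_paths V L).
Proof.
move=> u u' uu'.
have next_eq t : cap (next_time u t) = cap (next_time u' t).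
  rewrite !next_time_find; apply: eq_in_find => k; rewrite mem_iota add0n => /andP[_ kL].
  rewrite /revisits uu'//; congr (_ && (_ \in _)); apply/eq_in_map => j.
  by rewrite mem_index_iota => /andP[_ jk]; apply: uu'; lia.
have cap_big (o : option nat) (w : nat -> V) : cap o = L.+1 ->
    cap (obind (next_time w) o) = L.+1.
  case: o => [t|//] /= tL; case nt: (next_time w t) => [k|//] /=.
  by have := next_time_ge nt; lia.
have cut_eq i : cut_time L u i = cut_time L u' i.
  rewrite /cut_time -!/(cap _); elim: i => [//|i ih] /=.
  have [big|small] := eqVneq (cap (tau u i)) L.+1.
    by rewrite !cap_big// -ih.
  case tu: (tau u i) ih small => [t|] /=; last by rewrite eqxx.
  case tu': (tau u' i) => [t'|] /=; last by lia.
  by move=> ih small; rewrite next_eq; congr (cap (next_time _ _)); lia.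
apply: eq_from_tnth => i; rewrite !tnth_mktuple /simple_path !cut_eq.
apply/eq_in_map => j; rewrite mem_index_iota => /andP[_ jc]; apply: uu'.
by have := cut_time_le L u' i.+1; lia.
Qed.

End SplitDetermined.

(** * The costs of the Snake algorithm *)

Section Cost.
Variables (R : realType) (V : finType) (E : {set {set V}}).
Variable phi : {set V} -> R -> R -> R.
Hypothesis phi_convex : forall e, e \in E ->
  convex_function setT (fun q : R^o * R^o => phi e q.1 q.2).
Variable F : 'rV[R]_#|V| -> R.
Hypothesis F_convex : convex_function setT F.
Hypothesis F_diff : forall x, differentiable F x.
Hypothesis gradF_lip : lipschitz (gradient F).
Variable L : nat.
Implicit Types (q : seq V) (s : L.-tuple (seq V)) (x y : 'rV[R]_#|V|).

Definition path_cost q x : R := snake_f E F L q x + snake_g phi L q x.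

Definition sample_cost s x : R := \sum_(i < L) path_cost (nth [::] s i) x.

Definition edge_path q : bool :=
  all (fun p => [set p.1; p.2]%SET \in E) (zip q (behead q)).

Definition edge_sample s : bool := [forall i : 'I_L, edge_path (nth [::] s i)].

(** Convexity in each variable separately reduces the bound to the four corners
    of the square. *)
Lemma convex_box_le (f : R -> R -> R) (r a b : R) :
  convex_function setT (fun q : R^o * R^o => f q.1 q.2) ->
  `|a| <= r -> `|b| <= r ->
  f a b <= `|f r r| + `|f r (- r)| + `|f (- r) r| + `|f (- r) (- r)|.
Proof.
move=> /convex_functionP cf ar br.
have [r0|r0] := leP r 0.
  have -> : a = r by apply/eqP; rewrite -subr_eq0; move: ar; rewrite ler_norml; lra.
  have -> : b = r by apply/eqP; rewrite -subr_eq0; move: br; rewrite ler_norml; lra.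
  by have := ler_norm (f r r); have := normr_ge0 (f r (- r));
     have := normr_ge0 (f (- r) r); have := normr_ge0 (f (- r) (- r)); lra.
have weight c : `|c| <= r -> exists2 t : R, 0 <= t <= 1 & c = t * r + (1 - t) * (- r).
  rewrite ler_norml => /andP[c1 c2]; exists ((c + r) / (2 * r)).
    by rewrite divr_ge0 ?ler_pdivrMr; lra.
  by field; lra.
have [t t01 aE] := weight a ar; have [t' t'01 bE] := weight b br.
have fa c : f a c <= t * f r c + (1 - t) * f (- r) c.
  have := cf t (r, c) (- r, c) t01 => /=; rewrite /GRing.scale/= -mulrDl subrKC mul1r.
  by rewrite -aE.
have fb c : f c b <= t' * f c r + (1 - t') * f c (- r).
  have := cf t' (c, r) (c, - r) t'01 => /=; rewrite /GRing.scale/= -mulrDl subrKC mul1r.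
  by rewrite -bE.
have hull (w u1 u2 U1 U2 : R) : 0 <= w <= 1 -> u1 <= U1 -> u2 <= U2 -> 0 <= U1 -> 0 <= U2 ->
    w * u1 + (1 - w) * u2 <= U1 + U2.
  by move=> /andP[w0 w1] *; nra.
apply: le_trans (fa b) _; rewrite -addrA; apply: (hull _ _ _ _ _ t01); rewrite ?addr_ge0//;
  apply: le_trans (fb _) _; exact: (hull _ _ _ _ _ t'01 (ler_norm _) (ler_norm _)).
Qed.

Lemma edge_term_convex e a b : e \in E ->
  convex_function setT (fun x => phi e (at_vertex x a) (at_vertex x b)).
Proof.
move=> eE; apply/convex_functionP => t x y t01.
have := (convex_functionP _).1 (phi_convex eE) t
  (at_vertex x a, at_vertex x b) (at_vertex y a, at_vertex y b) t01.
by rewrite /at_vertex !mxE.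
Qed.

Lemma edge_term_slope_bounded e a b : e \in E ->
  slope_bounded (fun x => phi e (at_vertex x a) (at_vertex x b)).
Proof.
move=> eE; apply: convex_slope_bounded; first exact: edge_term_convex.
move=> r; eexists => x xr.
by apply: (convex_box_le (r := r) (phi_convex eE)); apply: le_trans xr; exact: ler_coord_norm.
Qed.

Lemma snake_g_convex q : edge_path q -> convex_function setT (snake_g phi L q).
Proof.
move=> /allP qE; apply: convex_functionZ; first by rewrite invr_ge0.
by apply: convex_function_sum => p /qE; exact: edge_term_convex.
Qed.

Lemma snake_g_slope_bounded q : edge_path q -> slope_bounded (snake_g phi L q).
Proof.
move=> /allP qE; apply: slope_boundedZ; first by rewrite invr_ge0.
by apply: slope_bounded_sum => p /qE; exact: edge_term_slope_bounded.
Qed.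

Definition path_weight q : R := (walk_length q)%:R / (L%:R * #|E|%:R).

Lemma path_weight_ge0 q : 0 <= path_weight q.
Proof. by rewrite divr_ge0// mulr_ge0. Qed.

Lemma path_cost_convex q : edge_path q -> convex_function setT (path_cost q).
Proof.
move=> qE; apply: convex_functionD; last exact: snake_g_convex.
exact: convex_functionZ (path_weight_ge0 q) F_convex.
Qed.

Lemma path_cost_slope_bounded q : edge_path q -> slope_bounded (path_cost q).
Proof.
move=> qE; apply: slope_boundedD; last exact: snake_g_slope_bounded.
exact: slope_boundedZ (path_weight_ge0 q) (smooth_slope_bounded F_convex F_diff gradF_lip).
Qed.

Lemma edge_sampleP s i : edge_sample s -> (i < L)%N -> edge_path (nth [::] s i).
Proof. by move=> /forallP sE iL; exact: (sE (Ordinal iL)). Qed.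

Lemma sample_cost_convex s : edge_sample s -> convex_function setT (sample_cost s).
Proof.
by move=> sE; apply: convex_function_sum => i _; apply: path_cost_convex; exact: edge_sampleP.
Qed.

Lemma sample_cost_slope_bounded s : edge_sample s -> slope_bounded (sample_cost s).
Proof.
by move=> sE; apply: slope_bounded_sum => i _; apply: path_cost_slope_bounded; exact: edge_sampleP.
Qed.

(** For small [c] the coefficient of [sqnorm (y - x)] in [prox_gradient_le] is at
    most [- 2^-1], uniformly over the finitely many weights of the smooth part. *)
Lemma snake_update_le (supp : seq (L.-tuple (seq V))) : all edge_sample supp ->
  exists2 c0 : R, 0 < c0 & forall c s i x z, 0 < c <= c0 -> s \in supp -> (i < L)%N ->
    forall q y, q = nth [::] s i -> y = snake_update E phi F L c q x ->
    sqnorm (y - z) <= sqnorm (x - z) - 2 * c * (path_cost q y - path_cost q z)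
      - 2^-1 * sqnorm (y - x).
Proof.
move=> /allP suppE; have [M M0 FM] := smooth_convex_le F_convex F_diff gradF_lip.
have [W W0 sW] : exists2 W : R, 0 <= W & forall s i, s \in supp -> (i < L)%N ->
    path_weight (nth [::] s i) <= W.
  apply: uniform_constant2 => [s i K K' KK' sK|s i _ _]; first exact: le_trans KK'.
  by exists (path_weight (nth [::] s i)) => //; exact: path_weight_ge0.
(* the bound 1 / (4 (W M + 1)) on c gives 1 - 2 c W M >= 1/2 *)
have B0 : 0 < 4 * (W * M + 1) by have := mulr_ge0 W0 M0; lra.
exists (4 * (W * M + 1))^-1 => [|c s i x z /andP[c0 cc] ss iL q y qE yE]; first by rewrite invr_gt0.
have qpath : edge_path q by rewrite qE; apply: edge_sampleP => //; exact: suppE.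
have := prox_gradient_le F_convex F_diff (y := y) (x := x) z FM (path_weight_ge0 q)
  (ltW c0) (snake_g_convex qpath) (snake_g_slope_bounded qpath).
rewrite -(gradientZ (path_weight q) (F_diff x)) => /(_ yE).
move=> /le_trans; apply; rewrite lerD2l lerN2 ler_wpM2r ?sqnorm_ge0//.
have wM : path_weight q * M <= W * M by rewrite ler_wpM2r// qE sW.
have wM0 : 0 <= path_weight q * M by rewrite mulr_ge0// path_weight_ge0.
have : c * (4 * (W * M + 1)) <= 1 by rewrite -ler_pdivlMr// mul1r.
nra.
Qed.

(** The descent inequality with [z = x]: the squared displacement is at most a
    multiple of [c] times the decrease of the cost, itself at most [K] times the
    displacement. *)
Lemma snake_update_dist (supp : seq (L.-tuple (seq V))) (r : R) : all edge_sample supp ->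
  exists c0 K : R, [/\ 0 < c0, 0 <= K & forall c s i x, 0 < c <= c0 -> s \in supp ->
    (i < L)%N -> `|x| <= r -> `|snake_update E phi F L c (nth [::] s i) x - x| <= K * c].
Proof.
move=> suppE; have [c0 c00 upd] := snake_update_le suppE.
have [K K0 sK] : exists2 K : R, 0 <= K & forall s i, s \in supp -> (i < L)%N ->
    forall x y, `|x| <= r ->
    path_cost (nth [::] s i) x - K * `|y - x| <= path_cost (nth [::] s i) y.
  apply: uniform_constant2 => [s i K K' KK' sK x y xr|s i ss iL].
    by apply: le_trans (sK x y xr); rewrite lerB// ler_wpM2r.
  have sE : edge_sample s by exact: (allP suppE).
  have [K K0 hK] := path_cost_slope_bounded (edge_sampleP sE iL) r.
  by exists K.
exists c0, (2 * K); split => // [|c s i x cc ss iL xr]; first exact: mulr_ge0.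
have := upd c s i x x cc ss iL _ _ erefl erefl; rewrite subrr sqnorm0.
set y := snake_update _ _ _ _ _ _ _; have := sK s i ss iL x y xr.
have := sqr_norm_le_sqnorm (y - x); have := normr_ge0 (y - x); case/andP: cc => c0' _.
have [yx|yx] := eqVneq (`|y - x|) 0.
  by move=> *; rewrite yx mulr_ge0 ?(ltW c0')// mulr_ge0.
move=> yx0; have {yx yx0} : 0 < `|y - x| by rewrite lt_neqAle eq_sym yx.
move: (`|y - x|) (sqnorm (y - x)) => t sq t0 tsq sl st.
rewrite -(ler_pM2l t0) -expr2.
have : 0 <= t * K * c by rewrite !mulr_ge0// ltW.
have := ler_wpM2l (ltW c0') sl; lra.
Qed.

Lemma snake_pass_le (supp : seq (L.-tuple (seq V))) (r : R) xs : all edge_sample supp ->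
  0 < r -> exists c0 K : R, [/\ 0 < c0, 0 <= K & forall c s x, 0 < c <= c0 -> s \in supp ->
    sqnorm (snake_inner E phi F c s x L - xs) <= sqnorm (x - xs)
      - 2 * c * ray_increment r xs (sample_cost s) x + K * c ^+ 2].
Proof.
move=> suppE r0; have [c0 c00 upd] := snake_update_le suppE.
have [K K0 sK] : exists2 K : R, 0 <= K & forall s i, s \in supp -> (i < L)%N ->
    forall x y, ray_increment r xs (path_cost (nth [::] s i)) x - K * `|y - x| <=
      path_cost (nth [::] s i) y - path_cost (nth [::] s i) xs.
  apply: uniform_constant2 => [s i K K' KK' sK x y|s i ss iL].
    by apply: le_trans (sK x y); rewrite lerB// ler_wpM2r.
  have sE : edge_sample s by exact: (allP suppE).
  have qE := edge_sampleP sE iL.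
  have [K K0 [_ hK]] :=
    ray_increment_bounds xs r0 (path_cost_convex qE) (path_cost_slope_bounded qE).
  by exists K.
exists c0, (2 * (L%:R ^+ 3 * K ^+ 2)); split => // [|c s x cc ss].
  by rewrite !mulr_ge0// exprn_ge0.
have := @incremental_pass_le R #|V| L (snake_inner E phi F c s x) (fun i => path_cost (nth [::] s i))
  (fun i => ray_increment r xs (path_cost (nth [::] s i)) x) xs c K.
have -> : \sum_(i < L) ray_increment r xs (path_cost (nth [::] s i)) x =
    ray_increment r xs (sample_cost s) x.
  rewrite /sample_cost; under [in RHS]eq_fun do under eq_bigr do rewrite -[path_cost _ _]mul1r.
  by rewrite ray_increment_sum; apply: eq_bigr => i _; rewrite mul1r.
case/andP: (cc) => cpos _; apply => //; first exact: ltW.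
- by move=> i iL; exact: upd cc ss iL _ _ erefl erefl.
- by move=> i iL; exact: sK.
Qed.

End Cost.

(** * The mean cost of a random sample *)

Section MeanCost.
Variables (R : realType) (V : finType) (E : {set {set V}}).
Hypothesis hE : simple_graph E.
Hypothesis hE0 : (0 < #|E|)%N.
Variable phi : {set V} -> R -> R -> R.
Hypothesis phi_sym : forall e, e \in E -> forall a b : R, phi e a b = phi e b a.
Variable F : 'rV[R]_#|V| -> R.
Variable L : nat.
Hypothesis hL : (0 < L)%N.

Definition edge_cost (x : 'rV[R]_#|V|) (a b : V) : R :=
  F x / (L%:R * #|E|%:R) + L%:R^-1 * phi [set a; b]%SET (at_vertex x a) (at_vertex x b).

Lemma split_cost (u : nat -> V) x :
  (forall k, (k < L)%N -> [set u k; u k.+1]%SET \in E) ->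
  sample_cost E phi F (split_paths L u) x =
  \sum_(0 <= k < L) edge_cost x (u k) (u k.+1).
Proof.
move=> uE; rewrite -(sum_cut_time hE uE (fun k => edge_cost x (u k) (u k.+1))).
apply: eq_bigr => i _; rewrite nth_split_paths//.
rewrite /path_cost /snake_f /snake_g /walk_length (size_simple_path hE uE) /=.
rewrite /walk_regularizer (zip_simple_path hE uE) big_map big_split/= sumr_const_nat mulr_sumr.
by rewrite -(mulr_natl (F x / _)) mulrA mulrAC.
Qed.

Lemma sum_edge_cost x :
  \sum_(q : V * V) ([set q.1; q.2]%SET \in E)%:R / (2 * #|E|%:R) * edge_cost x q.1 q.2 =
  (F x + regularizer E phi x) / #|E|%:R / L%:R.
Proof.
have L0 : L%:R != 0 :> R by rewrite pnatr_eq0 -lt0n.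
have E0 : #|E|%:R != 0 :> R by rewrite pnatr_eq0 -lt0n.
have count_edges : \sum_(q : V * V) ([set q.1; q.2]%SET \in E)%:R = 2 * #|E|%:R :> R.
  have := sum_oriented_edges hE (f := fun _ _ => 1 : R) (fun _ _ _ => erefl).
  under eq_bigr do rewrite mulr1.
  move=> ->; rewrite -sum1_card natr_sum; congr (2 * _); apply: eq_bigr => e eE.
  have := hE eE; rewrite cardE.
  by case: (enum e) => [|i [|j []]].
have sum_phi := sum_oriented_edges hE (f := fun a b =>
  phi [set a; b]%SET (at_vertex x a) (at_vertex x b)).
have -> : \sum_(q : V * V) ([set q.1; q.2]%SET \in E)%:R / (2 * #|E|%:R) * edge_cost x q.1 q.2 =
  F x / (L%:R * #|E|%:R) / (2 * #|E|%:R) * \sum_(q : V * V) ([set q.1; q.2]%SET \in E)%:R +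
  L%:R^-1 / (2 * #|E|%:R) * \sum_(q : V * V) ([set q.1; q.2]%SET \in E)%:R *
    phi [set q.1; q.2]%SET (at_vertex x q.1) (at_vertex x q.2).
  rewrite !mulr_sumr -big_split/=; apply: eq_bigr => q _.
  rewrite /edge_cost; field; exact/andP.
rewrite count_edges sum_phi => [|a b abE]; last by rewrite phi_sym// finset.setUC.
have -> : \sum_(e in E) (if enum e is [:: i; j]
    then phi [set i; j]%SET (at_vertex x i) (at_vertex x j) else 0) = regularizer E phi x.
  apply: eq_bigr => e eE; have := hE eE; rewrite cardE.
  have e_mem z : (z \in e) = (z \in enum e) by rewrite mem_enum.
  case: (enum e) e_mem => [|i [|j []]]// e_mem _.
  by congr (phi _ _ _); apply/setP => z; rewrite e_mem !inE.
by field; apply/andP.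
Qed.

Context {d : measure_display} {T : measurableType d} (P : probability T R).
Variable v : nat -> T -> V.
Hypothesis v_chain : markov_chain E P v.

Definition split_rv (w : T) : L.-tuple (seq V) := split_paths L (trajectory v w).

Definition split_values : seq (L.-tuple (seq V)) :=
  undup [seq split_paths L (fun k => t (inord k)) | t : {ffun 'I_L.+1 -> V}].

Lemma measurable_split_rv (A : set (L.-tuple (seq V))) : measurable (split_rv @^-1` A).
Proof.
have [a0 _] : exists a0 : V, True.
  move: hE0; rewrite card_gt0 => /set0Pn[e eE].
  have : (0 < #|e|)%N by rewrite hE.
  by rewrite card_gt0 => /set0Pn[a _]; exists a.
apply: (measurable_determined a0 (chain_meas v_chain) (N := L.+1)
  (Q := fun u => A (split_paths L u))).
by move=> u u' uu'; rewrite (split_paths_det uu').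
Qed.

Lemma split_rv_finite : finite_rv split_values split_rv.
Proof.
split=> [|w|s]; [exact: undup_uniq| |exact: measurable_split_rv].
rewrite mem_undup; apply/mapP; exists (history v L w); first by rewrite mem_enum.
apply: split_paths_det => k kL; by rewrite ffunE inordK.
Qed.

(** The tiling turns the cost of a sample into a sum over the steps of the walk,
    each of which is a uniformly distributed oriented edge. *)
Lemma mean_sample_cost x :
  mean P split_values split_rv (fun s => sample_cost E phi F s x) =
  (F x + regularizer E phi x) / #|E|%:R.
Proof.
have [mG G0] := walks_on_edges_full hE0 v_chain L.
pose cost_of (k : nat) (t : {ffun 'I_L.+1 -> V}) := edge_cost x (t (inord k)) (t (inord k.+1)).
rewrite (mean_eq split_rv_finite (history_rv v_chain L)
  (g := fun t => \sum_(k <- index_iota 0 L) cost_of k t) mG G0); last first.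
  move=> w Gw; rewrite split_cost//; apply: eq_big_nat => k /andP[_ kL].
  by rewrite /cost_of !ffunE !inordK// ltnW.
rewrite mean_sum.
have -> : \sum_(k <- index_iota 0 L) mean P (index_enum {ffun 'I_L.+1 -> V}) (history v L)
      (cost_of k) = \sum_(k <- index_iota 0 L) (F x + regularizer E phi x) / #|E|%:R / L%:R.
  rewrite big_seq [RHS]big_seq; apply: eq_bigr => k.
  rewrite mem_index_iota => /andP[_ kL]; rewrite -sum_edge_cost.
  rewrite (mean_eq (history_rv v_chain L) (pair_rv v_chain k)
    (g := fun q => edge_cost x q.1 q.2) (@measurableT _ _)).
  - by rewrite /mean; apply: eq_bigr => -[a b] _; rewrite (pair_law hE0 v_chain).
  - by rewrite setCT Pr_set0.
  - by move=> w _; rewrite /cost_of !ffunE !inordK// ltnW.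
rewrite sumr_const_nat subn0 -(mulr_natr (_ / L%:R)) divfK// pnatr_eq0; lia.
Qed.

Definition split_law (s : L.-tuple (seq V)) : R := Pr P (split_rv @^-1` [set s]).

(** Restricting to positive probabilities guarantees that the walks follow edges,
    hence that the costs are convex. *)
Definition split_support := [seq s <- split_values | split_law s != 0].

Lemma split_law_sum : \sum_(s <- split_support) split_law s = 1.
Proof.
rewrite big_filter big_mkcond/= -(@Pr_setT _ _ _ P).
rewrite (Pr_partition P split_rv_finite (@measurableT _ _)).
by apply: eq_bigr => s _; rewrite setTI; case: eqVneq.
Qed.

Lemma split_supportE (f : L.-tuple (seq V) -> R) :
  \sum_(s <- split_support) split_law s * f s = mean P split_values split_rv f.
Proof.
rewrite big_filter big_mkcond/=; apply: eq_bigr => s _.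
by case: eqVneq => // s0; rewrite -/(split_law s) s0 mul0r.
Qed.

Lemma split_support_edges : all (@edge_sample V E L) split_support.
Proof.
apply/allP => s; rewrite mem_filter => /andP[ps _].
have [mG G0] := walks_on_edges_full hE0 v_chain L.
have [[w [ws Gw]]|nG] := pselect (exists w, split_rv w = s /\ walks_on_edges E v L w).
  apply/forallP => i; rewrite -ws nth_split_paths//.
  exact: simple_path_edges hE Gw i.
case/negP: ps; rewrite eq_le Pr_ge0 andbT -G0; apply: le_Pr.
- exact: measurable_split_rv.
- exact: measurableC.
- by move=> w ws Gw; apply: nG; exists w.
Qed.

Lemma split_outside_support :
  P (split_rv @^-1` [set s | s \notin split_support]) = 0%E.
Proof.
have mA := measurable_split_rv.
rewrite PrE//; congr (_%:E); apply/eqP; rewrite eq_le Pr_ge0 andbT.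
pose l := [seq s <- split_values | split_law s == 0].
apply: (@le_trans _ _ (\sum_(s <- l) split_law s)); last first.
  by rewrite big_seq big1// => s; rewrite mem_filter => /andP[/eqP].
apply: (@Pr_cover_le _ _ _ P _ l _ set0) => // w /=; rewrite mem_filter => ws.
right; exists (split_rv w) => //=; rewrite mem_filter.
have [_ -> _] := split_rv_finite; rewrite andbT.
by move: ws; have [_ -> _] := split_rv_finite; rewrite andbT negbK.
Qed.

End MeanCost.

(** * Convergence of the Snake algorithm *)

Lemma eseries_shift1 (R : realType) (f : nat -> R) :
  (forall k, (0 < k)%N -> 0 <= f k) ->
  (\sum_(0 <= k <oo) (f k.+1)%:E = \sum_(1 <= k <oo) (f k)%:E)%E.
Proof.
move=> f0; pose f1 k := (if k is 0%N then 0 else f k)%:E.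
have f1_ge0 k : (0 <= f1 k)%E by rewrite lee_fin; case: k => // k; exact: f0.
have := nneseries_addn 1 f1_ge0; under eq_eseriesr do rewrite addn1; move=> ->.
congr (limn _); apply/funext => n; apply: eq_big_nat => k /andP[k0 _].
by rewrite /f1; case: k k0.
Qed.

Section IidCylinders.
Context {R : realType} {S : countType} {d' : measure_display} {T' : measurableType d'}.
Context {P' : probability T' R} {X : T' -> S} {d : measure_display}
  {T : measurableType d} {P : probability T R} {xi : nat -> T -> S}.
Hypothesis xi_iid : iid_copies P' X P xi.

Lemma iid_measurable k (A : set S) : measurable ((fun w => xi k.+1 w) @^-1` A).
Proof. by case: xi_iid => m _ _; exact: m. Qed.

(** Independence, in the form used to condition on the next sample. *)
Lemma iid_cylinderS N u :
  Pr P (cylinder (fun k => xi k.+1) N.+1 u) =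
  Pr P (cylinder (fun k => xi k.+1) N u) * Pr P' (X @^-1` [set u N]).
Proof.
have [_ xi_law xi_indep] := xi_iid.
have cylE M : cylinder (fun k => xi k.+1) M u =
    [set w | forall k, k \in iota 1 M -> [set u k.-1] (xi k w)].
  apply/seteqP; split => w /= h k; first by rewrite mem_iota; case: k => // k kM; exact: h.
  by move=> kM; apply: (h k.+1); rewrite mem_iota; lia.
have prodE M : P (cylinder (fun k => xi k.+1) M u) =
    (\prod_(k <- iota 1 M) P (xi k @^-1` [set u k.-1]))%E.
  rewrite cylE; apply: (xi_indep (iota 1 M) (fun k => [set u k.-1]) (iota_uniq 1 M)) => k.
  by rewrite mem_iota => /andP[].
have mC M : measurable (cylinder (fun k => xi k.+1) M u).
  exact: (measurable_cylinder iid_measurable).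
have xi_fin : P (xi N.+1 @^-1` [set u N]) \is a fin_num.
  by rewrite fin_num_measure//; exact: (iid_measurable N [set u N]).
rewrite {1}/Pr prodE -(addn1 N) iotaD big_cat/= big_seq1 add1n/= -prodE.
by rewrite fineM ?(fin_num_measure _ _ (mC N))// xi_law.
Qed.

End IidCylinders.

Lemma iteration_snake (R : realType) (V : finType) (E : {set {set V}}) phi
    (F : 'rV[R]_#|V| -> R) L gamma x0 (xi : nat -> L.-tuple (seq V)) k :
  iteration (fun c s x => snake_inner E phi F c s x L) (fun j => gamma j.+1) x0
    (fun j => xi j.+1) k = snake E phi F gamma x0 xi k.
Proof. by elim: k => [//|k ih] /=; rewrite ih. Qed.

Lemma coord_cvg (R : realType) n (x : nat -> 'rV[R]_n) (X : 'rV[R]_n) i :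
  x @ \oo --> X -> (fun k => x k ord0 i) @ \oo --> X ord0 i.
Proof.
by move=> xX; apply: (continuous_cvg _ (@coord_continuous R 1 n ord0 i X) xX).
Qed.

Lemma cvg_close (R : realType) n (x y : nat -> 'rV[R]_n) (e : nat -> R) (X : 'rV[R]_n) :
  x @ \oo --> X -> e @ \oo --> 0 -> (\forall k \near \oo, `|y k - x k| <= e k) ->
  y @ \oo --> X.
Proof.
move=> xX e0 yx; rewrite (_ : y = (fun k => x k + (y k - x k))); last first.
  by apply/funext => k; rewrite addrC subrK.
rewrite -[X]addr0; apply: cvgD => //; apply/norm_cvg0P.
apply: squeeze_cvgr (cvg_cst 0) e0.
by apply: filterS yx => k ->; rewrite normr_ge0.
Qed.

Unset Implicit Arguments.

Theorem theorem4 (R : realType) (V : finType) (E : {set {set V}})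
  (hE : simple_graph E) (hE0 : (0 < #|E|)%N)
  (phi : {set V} -> R -> R -> R)
  (phi_convex : forall e, e \in E ->
    convex_function setT (fun p : R^o * R^o => phi e p.1 p.2))
  (phi_sym : forall e, e \in E -> forall a b : R, phi e a b = phi e b a)
  (F : 'rV[R]_#|V| -> R)
  (F_convex : convex_function setT F)
  (F_diff : forall x, differentiable F x)
  (gradF_lip : lipschitz (gradient F))
  (F_min : exists x, minimizer (fun z => F z + regularizer E phi z) x)
  (gamma : nat -> R)
  (gamma_gt0 : forall n, (0 < n)%N -> 0 < gamma n)
  (gamma_sum : (\sum_(1 <= n <oo) (gamma n)%:E = +oo)%E)
  (gamma_sum2 : (\sum_(1 <= n <oo) (gamma n ^+ 2)%:E < +oo)%E)
  (gamma_ratio : gamma n.+1 / gamma n @[n --> \oo] --> (1 : R))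
  (L : nat) (hL : (0 < L)%N)
  (d' : measure_display) (Omega' : measurableType d')
  (P' : probability Omega' R) (v : nat -> Omega' -> V)
  (v_chain : markov_chain E P' v)
  (d : measure_display) (Omega : measurableType d)
  (P : probability Omega R) (xi : nat -> Omega -> L.-tuple (seq V))
  (xi_iid : iid_copies P' (fun w => split_paths L (fun k => v k w)) P xi)
  (x0 : 'rV[R]_#|V|) :
  exists Xstar : Omega -> 'rV[R]_#|V|,
    [/\ random_vector Xstar,
        {ae P, forall w,
          minimizer (fun z => F z + regularizer E phi z) (Xstar w)},
        {ae P, forall w,
          snake E phi F gamma x0 (fun n => xi n w) n @[n --> \oo] --> Xstar w}
      & forall i, (i < L)%N ->
        {ae P, forall w,
          snake_bar E phi F gamma x0 (fun n => xi n w) n i @[n --> \oo]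
            --> Xstar w}].
Proof.
pose eta k := xi k.+1; pose p := @split_law _ _ L _ _ P' v.
pose supp := split_support L P' v.
pose g k := gamma k.+1.
have g_gt0 k : 0 < g k by exact: gamma_gt0.
have g_sum : (\sum_(0 <= k <oo) (g k)%:E = +oo)%E.
  by rewrite (eseries_shift1 (f := gamma))// => k k0; exact/ltW/gamma_gt0.
have g_sum2 : cvgn (series (fun k => g k ^+ 2)).
  apply: nnseries_is_cvg => [k|]; first exact: sqr_ge0.
  by rewrite (eseries_shift1 (f := fun k => gamma k ^+ 2))// => k _; exact: sqr_ge0.
have eta_meas k (A : set (L.-tuple (seq V))) : measurable (eta k @^-1` A) := iid_measurable xi_iid k A.
have supp_edge := split_support_edges hE hE0 L v_chain.
have edgeS s : s \in supp -> edge_sample E s by exact: (allP supp_edge).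
have eta_supp k : P (eta k @^-1` [set s | s \notin supp]) = 0%E.
  have [_ xi_law _] := xi_iid; rewrite xi_law//.
  exact: (split_outside_support hE hE0 L v_chain).
have mean_costE x : mean_cost p supp (sample_cost E phi F (L := L)) x =
    (F x + regularizer E phi x) / #|E|%:R.
  rewrite /mean_cost (split_supportE P' v (fun s => sample_cost E phi F s x)).
  exact: mean_sample_cost.
have minE x : minimizer (mean_cost p supp (sample_cost E phi F (L := L))) x <->
    minimizer (fun z => F z + regularizer E phi z) x.
  have E1 : 0 < #|E|%:R^-1 :> R by rewrite invr_gt0 ltr0n.
  by split => xmin y; have := xmin y; rewrite !mean_costE ler_pM2r.
pose step c (s : L.-tuple (seq V)) (x : 'rV[R]_#|V|) := snake_inner E phi F c s x L.
have step_cvg : {ae P, forall w, exists X,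
    minimizer (mean_cost p supp (sample_cost E phi F (L := L))) X /\
    iteration step g x0 (trajectory eta w) @ \oo --> X}.
  apply: (iteration_cvg (nseq_tuple L [::]) eta_meas _ _ eta_supp) => //.
  - by move=> s; exact: Pr_ge0.
  - exact: (split_law_sum hE hE0 L v_chain).
  - by move=> N u; exact: (iid_cylinderS xi_iid).
  - by move=> s /edgeS; exact: sample_cost_convex.
  - by move=> s /edgeS; exact: sample_cost_slope_bounded.
  - move=> r xs r0 _.
    exact: (snake_pass_le phi_convex F_convex F_diff gradF_lip xs supp_edge r0).
  - by have [x xmin] := F_min; exists x; apply/minE.
pose sn w := snake E phi F gamma x0 (fun n => xi n w).
have snE w : iteration step g x0 (trajectory eta w) = sn w.
  by apply/funext => k; exact: iteration_snake.
(* the upper limit is measurable everywhere and is the limit when there is one *)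
pose Xstar w : 'rV[R]_#|V| := \row_i fine (limn_esup (fun k => (sn w k ord0 i)%:E)).
have XstarE w X : sn w @ \oo --> X -> Xstar w = X.
  move=> snX; apply/rowP => i; rewrite mxE.
  have snXi : (fun k => (sn w k ord0 i)%:E) @ \oo --> (X ord0 i)%:E.
    by apply: cvg_EFin; [exact: nearW|exact: coord_cvg].
  by rewrite (cvg_limn_einf_sup snXi).2.
have ae_lim : {ae P, forall w, minimizer (fun z => F z + regularizer E phi z) (Xstar w) /\
    sn w @ \oo --> Xstar w}.
  apply: filterS step_cvg => w [X [/minE Xmin]]; rewrite snE => snX.
  by rewrite (XstarE w X snX).
have ae_supp : {ae P, forall w, forall k, eta k w \in supp}.
  apply: ae_foralln => k; exists (eta k @^-1` [set s | s \notin supp]); split.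
  - exact: eta_meas.
  - exact: eta_supp.
  - by move=> w /= /negP.
exists Xstar; split.
- move=> a; rewrite /at_vertex; rewrite (_ : (fun w => _) =
      fine \o (fun w => limn_esup (fun k => (sn w k ord0 (enum_rank a))%:E))); last first.
    by apply/funext => w; rewrite mxE.
  apply: measurableT_comp; first exact: fine_measurable.
  apply: measurable_fun_limn_esup => k.
  apply/measurable_EFinP => _ B _.
  rewrite setTI (_ : _ @^-1` B =
      [set w | B (iteration step g x0 (trajectory eta w) k ord0 (enum_rank a))]); last first.
    by apply/seteqP; split => w /=; rewrite snE.
  apply: (measurable_determined (nseq_tuple L [::]) eta_meas (N := k)
    (Q := fun u => B (iteration step g x0 u k ord0 (enum_rank a)))).
  by move=> u u' uu'; rewrite (iteration_det step g x0 uu').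
- by apply: filterS ae_lim => w [].
- by apply: filterS ae_lim => w [].
move=> i iL; apply: filterS2 ae_lim ae_supp => w [_ snX] wsupp.
(* the pass numbered k.+1 starts from the k-th iterate *)
rewrite -cvg_shiftS /snake_bar /=.
elim: i iL => [|i ih] iL /=; first exact: snX.
have {ih} yX := ih (ltnW iL).
set y := (fun k : nat => _) in yX.
have [r yr] : exists r : R, forall k, `|y k| <= r.
  have [B hB] := cvgn_bounded (cvgP _ (cvg_norm yX)).
  by exists B => k; have := hB k; rewrite normr_id.
have [c0 [K [c00 K0 dist]]] := snake_update_dist phi_convex F_convex F_diff gradF_lip r supp_edge.
have g0 : g @ \oo --> 0.
  apply/cvgrPdist_le => e e0; apply: filterS (small_steps g_gt0 g_sum2 e0) => k.
  by rewrite sub0r normrN gtr0_norm.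
have Kg0 : K * g k @[k --> \oo] --> 0 by rewrite -(mulr0 K); exact: cvgMr.
apply: cvg_close yX Kg0 _.
apply: filterS (small_steps g_gt0 g_sum2 c00) => k gk.
apply: dist => //; first by rewrite g_gt0.
- exact: wsupp.
- exact: ltnW.
- exact: yr.
Qed.
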